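(* Let $K$ be a differential field of characteristic $0$ with algebraically closed field of constants $C$, and let $M$ be a Picard-Vessiot extension of $K$. Then the dimension of the differential Galois group of $M/K$ (as an algebraic group of matrices over $C$) equals the transcendence degree of $M$ over $K$.
   Context: A differential field is a field with one derivation $y\mapsto y'$; its constants are the elements of derivative zero. For elements $u_1,\dots,u_n$ of a differential extension of $K$, $K(u_1,\dots,u_n)$ denotes the differential subfield generated by $K$ and $u_1,\dots,u_n$. Elements $u_1,\dots,u_n$ that are solutions of a homogeneous linear differential equation of order $n$ over $K$ form a fundamental system of solutions if their wronskian $\det(u_i^{(j-1)})_{1\le i,j\le n}$ is nonzero. A differential extension $M\supseteq K$ is a Picard-Vessiot extension of $K$ if $M=K(u_1,\dots,u_n)$ for a fundamental system of solutions of some homogeneous linear differential equation over $K$ and $M$ has the same field of constants as $K$. The differential Galois group of $M/K$ is the group of all differential field automorphisms of $M$ fixing $K$ elementwise; via $\sigma u_i=\sum_j c_{ij}u_j$ it is an algebraic group of matrices in $GL_n(C)$. To an algebraic group of $n\times n$ matrices is associated the ideal $S[\bar x]$ of polynomials in $C[\bar x]$ ($n^2$ variables) vanishing on it; the group is irreducible if this ideal is prime. The dimension of an irreducible algebraic group is the transcendence degree over $C$ of the ring $C[\bar x]/S[\bar x]$. The dimension of an arbitrary algebraic group is the dimension of its irreducible algebraic subgroup of finite index containing the identity (its identity component). The transcendence degree of $M/K$ is the usual algebraic one. *)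

(* Defs.v *)
From HB Require Import structures.
From mathcomp Require Import all_boot all_order all_algebra.
From mathcomp Require Import mpoly.
From mathcomp Require Import boolp classical_sets.

Set Implicit Arguments.
Unset Strict Implicit.
Unset Printing Implicit Defensive.

Import GRing.Theory.
Local Open Scope ring_scope.
Local Open Scope classical_set_scope.
Local Open Scope quotient_scope.

HB.mixin Record isDifferential F of GRing.Field F := {
  der : F -> F;
  derD : {morph der : x y / x + y};
  derM : forall x y, der (x * y) = der x * y + x * der y
}.

#[short(type="diffFieldType")]
HB.structure Definition DiffField := {F of GRing.Field F & isDifferential F}.

Section Constants.
Variable K : diffFieldType.

Lemma der0 : der (0 : K) = 0.
Proof. by apply: (@addrI _ (der (0 : K))); rewrite -derD !addr0. Qed.

Lemma derN (x : K) : der (- x) = - der x.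
Proof. by apply/eqP; rewrite -addr_eq0 -derD addNr der0. Qed.

Lemma der1 : der (1 : K) = 0.
Proof.
by apply: (@addrI _ (der (1 : K))); rewrite addr0 -{3}(mulr1 1) derM mulr1 mul1r.
Qed.

Definition is_const : {pred K} := [pred x | der x == 0].

Fact is_const_divring_closed : divring_closed is_const.
Proof.
split=> [|x y|x y]; rewrite !inE; first by rewrite der1.
- by move=> /eqP hx /eqP hy; rewrite derD derN hx hy subr0.
move=> /eqP hx /eqP hy; rewrite derM hx mul0r add0r mulf_eq0; apply/orP; right.
have [->|y0] := eqVneq y 0; first by rewrite invr0 der0.
apply/eqP/(mulfI y0); rewrite mulr0.
by have := derM y y^-1; rewrite mulfV // der1 hy mul0r add0r => <-.
Qed.

HB.instance Definition _ :=
  GRing.isDivringClosed.Build K is_const is_const_divring_closed.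

Record constants := Constant {
  const_val : K;
  const_valP : const_val \in is_const
}.

HB.instance Definition _ := [isSub for const_val].
HB.instance Definition _ := [Choice of constants by <:].
HB.instance Definition _ := [SubChoice_isSubComUnitRing of constants by <:].
HB.instance Definition _ := [SubComUnitRing_isSubIntegralDomain of constants by <:].
HB.instance Definition _ := [SubIntegralDomain_isSubField of constants by <:].

End Constants.

Section TranscendenceDegree.
Variables (F A : comNzRingType) (f : F -> A).

Definition alg_independent (d : nat) (s : 'I_d -> A) : Prop :=
  forall p : {mpoly F[d]}, mmap f s p = 0 -> p = 0.

(* The transcendence degree of A over F, with A an F-algebra through f, is the
   largest number of elements of A that are algebraically independent over F. *)
Definition has_trdeg (d : nat) : Prop :=
  (exists s : 'I_d -> A, alg_independent s) /\
  (forall (e : nat) (s : 'I_e -> A), alg_independent s -> (e <= d)%N).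

End TranscendenceDegree.

Section AlgebraicMatrixGroups.
Variables (C : fieldType) (n : nat).
Implicit Types (G H : set 'M[C]_n) (p : {mpoly C[n * n]}).

Definition mx_eval p (c : 'M[C]_n) : C := p.@[fun k => mxvec c 0 k].

(* A subgroup of GL_n(C) cut out in GL_n(C) by polynomial equations. *)
Definition algebraic_group G : Prop :=
  [/\ exists P : set {mpoly C[n * n]},
        G = [set c | c \in unitmx /\ forall p, P p -> mx_eval p c = 0],
      G 1%:M,
      forall a b, G a -> G b -> G (a *m b)
    & forall a, G a -> G (invmx a)].

Record algGroup := AlgGroup {
  algGroup_set :> set 'M[C]_n;
  algGroupP : algebraic_group algGroup_set
}.

Definition vanishing_ideal (G : algGroup) : {pred {mpoly C[n * n]}} :=
  [pred p | `[< G `<=` [set c | mx_eval p c = 0] >]].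

Fact vanishing_ideal_closed (G : algGroup) : idealr_closed (vanishing_ideal G).
Proof.
have [_ G1 _ _] := algGroupP G; split.
- by apply/asboolP => c _ /=; rewrite /mx_eval rmorph0.
- apply/negP => /asboolP /(_ _ G1) /=; rewrite /mx_eval rmorph1.
  exact/eqP/oner_neq0.
move=> a p q /asboolP hp /asboolP hq; apply/asboolP => c Gc /=.
have /= := hp _ Gc; have /= := hq _ Gc; rewrite /mx_eval rmorphD rmorphM /=.
by move=> -> ->; rewrite mulr0 addr0.
Qed.

HB.instance Definition _ (G : algGroup) :=
  isIdealr.Build {mpoly C[n * n]} (vanishing_ideal G) (vanishing_ideal_closed G).

(* The ideal is proper by construction, so this states that it is prime. *)
Definition irreducible_group (G : algGroup) : Prop :=
  prime_idealr_closed (vanishing_ideal G).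

Definition coord_ring (G : algGroup) : comNzRingType :=
  {ideal_quot (vanishing_ideal G)}.

Definition coord_ringC (G : algGroup) (a : C) : coord_ring G :=
  \pi_({ideal_quot (vanishing_ideal G)}) a%:MP.

Definition finite_index H G : Prop :=
  exists s : seq 'M[C]_n,
    forall g, G g -> exists2 c, c \in s & G c /\ H (invmx c *m g).

(* [H] is the irreducible algebraic subgroup of finite index of [G], which is
   unique when it exists; it contains the identity, being a group. *)
Definition identity_component G (H : algGroup) : Prop :=
  [/\ H `<=` G, finite_index H G & irreducible_group H].

Definition has_group_dim G (d : nat) : Prop :=
  algebraic_group G /\
  exists2 H : algGroup, identity_component G H & has_trdeg (@coord_ringC H) d.

End AlgebraicMatrixGroups.

Section PicardVessiot.
(* [iota] makes M an extension of K; it is a differential one when [iota]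
   commutes with the derivations, which [picard_vessiot] below requires. *)
Variables (K M : diffFieldType) (iota : {rmorphism K -> M}) (n : nat).
Implicit Type u : 'I_n -> M.

Definition diff_subfield (S : set M) : Prop :=
  [/\ S 1, forall x y, S x -> S y -> S (x - y),
      forall x y, S x -> S y -> S (x / y) & forall x, S x -> S (der x)].

(* K(u_1, ..., u_n) *)
Definition diff_generated u : set M :=
  smallest diff_subfield (range iota `|` range u).

(* y^(n) + a_(n-1) y^(n-1) + ... + a_0 y = 0 *)
Definition lin_diff_eq (a : 'I_n -> K) (y : M) : Prop :=
  iter n der y + \sum_(j < n) iota (a j) * iter j der y = 0.

Definition wronskian u : M := \det (\matrix_(i < n, j < n) iter j der (u i)).

Definition fundamental_system (a : 'I_n -> K) u : Prop :=
  (forall i, lin_diff_eq a (u i)) /\ wronskian u != 0.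

(* M is a Picard-Vessiot extension of K, generated by the fundamental system u *)
Definition picard_vessiot u : Prop :=
  [/\ {morph iota : x / der x},
      exists a : 'I_n -> K, fundamental_system a u,
      diff_generated u = [set: M]
    & forall x : M, x \in @is_const M -> exists c : constants K, iota (val c) = x].

Definition diff_galois (sigma : {rmorphism M -> M}) : Prop :=
  [/\ bijective sigma, {morph sigma : x / der x}
    & forall x : K, sigma (iota x) = iota x].

(* The matrices (c_ij) such that sigma u_i = \sum_j c_ij u_j for some sigma in
   the differential Galois group. *)
Definition galois_matrices u : set 'M[constants K]_n :=
  [set c | exists2 sigma : {rmorphism M -> M}, diff_galois sigma &
           forall i, sigma (u i) = \sum_(j < n) iota (val (c i j)) * u j].

End PicardVessiot.

(* Main.v *)
(* Let Z be the wronskian matrix of u and C the field of constants. M is the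
   fraction field of K[Z], and the Galois group G consists of the c in GL_n(C)
   such that every polynomial relation of Z over K is satisfied by c Z. The
   fixed field of G is K: if a lies outside K, then a (x) 1 - 1 (x) a is not
   nilpotent in the tensor square of M over K, and since the ideal in M[Y] of
   the relations of Y Z is stable under the derivation, hence generated over C,
   the Nullstellensatz yields a point c of G which moves a.

   The identity component H is the union of the irreducible subsets of G through
   the identity. If some entries of Z are algebraically independent over K, then
   the corresponding entries of the generic point c Z of H Z are algebraically
   independent over M: by Artin's minimal-support argument a relation over M
   yields one fixed by H, and the product of its conjugates is a relation over K.
   As c and c Z generate the same ring over M, a transcendence basis of M over K
   among the entries of Z has as many elements as one of H. Transcendence degrees
   are compared by counting monomials. *)

Require Import Defs.
From HB Require Import structures.
From mathcomp Require Import all_boot all_order all_algebra.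
From mathcomp Require Import mpoly.
From mathcomp Require Import boolp classical_sets.
From mathcomp Require Import zify ring.

Set Implicit Arguments.
Unset Strict Implicit.
Unset Printing Implicit Defensive.

Import GRing.Theory.
Local Open Scope ring_scope.

(** * Ideals and noetherian rings *)

(** The obstacle is that only [C] is algebraically closed, while the relations that matter have
    coefficients in [M]. Coefficients are therefore expanded along elements of [M] linearly
    independent over [C], so that one equation over [M] at a matrix over [C] becomes finitely many
    equations over [C]. Counting monomials applies alike to prime ideals over [K], [C] and [M];
    primality serves to cancel leading coefficients, which is why an irreducible component has to
    replace the group. Characteristic 0 enters through the separability of a minimal polynomial, in
    the proof that the fixed field is [K]. *)

Section Ideals.
Variable R : comNzRingType.
Implicit Types (J : R -> Prop) (S : R -> Prop).

Definition is_ideal J :=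
  [/\ J 0, forall x y, J x -> J y -> J (x + y) & forall a x, J x -> J (a * x)].

Definition is_prime J :=
  [/\ is_ideal J, ~ J 1 & forall x y, J (x * y) -> J x \/ J y].

Definition ideal_gen S : R -> Prop :=
  fun x => forall J, is_ideal J -> (forall y, S y -> J y) -> J x.

Definition noetherian :=
  forall J, is_ideal J -> exists2 s : seq R,
    forall x, x \in s -> J x & forall x, J x -> ideal_gen (fun y => y \in s) x.

Lemma ideal_gen_ideal S : is_ideal (ideal_gen S).
Proof.
split=> [J [] //|x y hx hy J iJ hS|a x hx J iJ hS]; have [_ iD iM] := iJ.
  by apply: iD; [apply: hx|apply: hy].
by apply: iM; apply: hx.
Qed.

Lemma ideal_gen_mem S x : S x -> ideal_gen S x.
Proof. by move=> Sx J _; apply. Qed.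

Lemma ideal_gen_sub S T x :
  (forall y, S y -> T y) -> ideal_gen S x -> ideal_gen T x.
Proof. by move=> ST hx J iJ hT; apply: hx => // y /ST; apply: hT. Qed.

Lemma idealN J x : is_ideal J -> J x -> J (- x).
Proof. by move=> [_ _ iM] Jx; rewrite -mulN1r; apply: iM. Qed.

Lemma idealB J x y : is_ideal J -> J x -> J y -> J (x - y).
Proof. by move=> iJ Jx Jy; have [_ iD _] := iJ; apply: iD => //; apply: idealN. Qed.

Lemma idealMr J a x : is_ideal J -> J x -> J (x * a).
Proof. by move=> [_ _ iM] Jx; rewrite mulrC; apply: iM. Qed.

Lemma ideal_sum J (I : Type) (r : seq I) (P : pred I) (F : I -> R) :
  is_ideal J -> (forall i, P i -> J (F i)) -> J (\sum_(i <- r | P i) F i).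
Proof. by move=> [i0 iD _] h; apply: big_ind. Qed.

Lemma prime_exp J x k : is_prime J -> J (x ^+ k) -> J x.
Proof.
move=> [iJ J1 pJ]; elim: k => [|k IH]; first by rewrite expr0.
by rewrite exprS => /pJ [].
Qed.

(** Without a maximal member, choice gives a strictly increasing sequence in [F]; its union is an
    ideal whose finitely many generators all lie in one term, which then equals the next. *)
Lemma noetherian_maximal (F : (R -> Prop) -> Prop) :
  noetherian -> (forall J, F J -> is_ideal J) -> (exists J, F J) ->
  exists2 J, F J & forall J', F J' -> (forall x, J x -> J' x) ->
                              forall x, J' x -> J x.
Proof.
move=> nR Fi [J0 FJ0]; apply: contrapT => nomax.
have step (J : {J | F J}) : exists J' : {J | F J},
    (forall x, sval J x -> sval J' x) /\ exists2 x, sval J' x & ~ sval J x.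
  case: J => J FJ /=; apply: contrapT => h; apply: nomax; exists J => // J' FJ' sub x J'x.
  apply: contrapT => nJx; apply: h; exists (exist _ J' FJ') => /=; split=> //.
  by exists x.
have [nxt nxtP] := choice step.
pose ch k := iter k nxt (exist _ J0 FJ0).
have chS k x : sval (ch k) x -> sval (ch k.+1) x by have [+ _] := nxtP (ch k); apply.
have chle k l x : (k <= l)%N -> sval (ch k) x -> sval (ch l) x.
  move=> /subnK <-; elim: (l - k)%N => // j IH hx.
  by rewrite addSn; apply/chS/IH.
have chi k : is_ideal (sval (ch k)) by apply: Fi; case: (ch k).
pose U x := exists k, sval (ch k) x.
have iU : is_ideal U.
  split=> [|x y [k hx] [l hy]|a x [k hx]].
  - by exists 0%N; have [] := chi 0%N.
  - exists (maxn k l); have [_ iD _] := chi (maxn k l).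
    by apply: iD; [apply: chle hx; apply: leq_maxl|apply: chle hy; apply: leq_maxr].
  by exists k; have [_ _ iM] := chi k; apply: iM.
have [s sU genU] := nR U iU.
have [k hk] : exists k, forall x, x \in s -> sval (ch k) x.
  elim: s sU {genU} => [|a s IH] sU; first by exists 0%N.
  have [|k hk] := IH; first by move=> x xs; apply: sU; rewrite inE xs orbT.
  have [l hl] := sU a (mem_head _ _); exists (maxn k l) => x; rewrite inE => /orP[/eqP->|xs].
    by apply: chle hl; apply: leq_maxr.
  by apply: (chle k); [apply: leq_maxl | apply: hk].
have [_ [x x1 nx]] := nxtP (ch k); apply: nx.
by apply: (genU x) => //; exists k.+1.
Qed.

Lemma noetherian_ind (P : (R -> Prop) -> Prop) :
  noetherian ->
  (forall J, is_ideal J ->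
     (forall J', is_ideal J' -> (forall x, J x -> J' x) ->
        (exists2 x, J' x & ~ J x) -> P J') -> P J) ->
  forall J, is_ideal J -> P J.
Proof.
move=> nR IH J iJ; apply: contrapT => nPJ.
have [||J1 [iJ1 nP1] max1] := @noetherian_maximal (fun J => is_ideal J /\ ~ P J) nR.
- by move=> ? [].
- by exists J.
apply/nP1/IH => // J' iJ' sub [x J'x nx]; apply: contrapT => nPJ'.
by apply/nx/(max1 J').
Qed.

(* A maximal ideal among those containing [J] and no power of [r] is prime. *)
Lemma prime_avoiding J r :
  noetherian -> is_ideal J -> (forall k, ~ J (r ^+ k)) ->
  exists2 P, is_prime P & (forall x, J x -> P x) /\ ~ P r.
Proof.
move=> nR iJ Jr.
pose F P := [/\ is_ideal P, forall x, J x -> P x & forall k, ~ P (r ^+ k)].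
have [||P [iP JP Pr] maxP] := @noetherian_maximal F nR.
- by move=> ? [].
- by exists J; split.
exists P; last by split=> //; have := Pr 1%N; rewrite expr1.
split=> //; first by have := Pr 0%N; rewrite expr0.
(* The ideal [P + (x)] is strictly larger than [P], so by maximality it contains a power of [r]. *)
have grow x : ~ P x -> exists k, exists2 a, P a & exists b, r ^+ k = a + b * x.
  move=> nPx; apply: contrapT => h; apply: nPx.
  pose Q y := exists2 a, P a & exists b, y = a + b * x.
  have PQ y : P y -> Q y by move=> Py; exists y => //; exists 0; rewrite mul0r addr0.
  have [P0 PD PM] := iP.
  have iQ : is_ideal Q.
    split=> [|y z [a Pa [b ->]] [c Pc [d ->]]|e y [a Pa [b ->]]].
    - exact: PQ.
    - by exists (a + c); [apply: PD|exists (b + d); rewrite mulrDl addrACA].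
    by exists (e * a); [apply: PM|exists (e * b); rewrite mulrDr mulrA].
  apply: (maxP Q) => //.
    split=> // [y /JP/PQ //|k [a Pa [b e]]]; apply: h.
    by exists k, a => //; exists b.
  by exists 0 => //; exists 1; rewrite add0r mul1r.
move=> x y Pxy; apply: contrapT => /not_orP [/grow [k [a Pa [b ek]]] /grow [l [c Pc [d el]]]].
apply: (Pr (k + l)%N); rewrite exprD ek el mulrDl !mulrDr.
have [P0 PD PM] := iP; apply: (PD); apply: (PD).
- exact: PM.
- by rewrite mulrC; apply: PM.
- exact: PM.
by rewrite mulrACA; apply: PM.
Qed.

End Ideals.

Lemma ideal_preim (R S : comNzRingType) (f : {rmorphism R -> S}) J :
  is_ideal J -> is_ideal (fun x => J (f x)).
Proof.
move=> [i0 iD iM]; split=> [|x y hx hy|a x hx].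
- by rewrite rmorph0.
- by rewrite rmorphD; apply: iD.
by rewrite rmorphM; apply: iM.
Qed.

Lemma prime_preim (R S : comNzRingType) (f : {rmorphism R -> S}) J :
  is_prime J -> is_prime (fun x => J (f x)).
Proof.
move=> [iJ J1 pJ]; split; first exact: ideal_preim.
  by rewrite rmorph1.
by move=> x y; rewrite rmorphM; apply: pJ.
Qed.

Lemma noetherian_surj (R S : comNzRingType) (f : {rmorphism R -> S}) :
  (forall y, exists x, f x = y) -> noetherian R -> noetherian S.
Proof.
move=> surj nR J iJ; have [s sJ gJ] := nR _ (ideal_preim f iJ).
exists (map f s) => [_ /mapP [x xs ->]|y Jy]; first exact: sJ.
have [x fx] := surj y; rewrite -fx in Jy *.
move=> J' iJ' sJ'; apply: (gJ x Jy) (ideal_preim f iJ') _ => z zs.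
exact/sJ'/map_f.
Qed.

Lemma noetherian_field (F : fieldType) : noetherian F.
Proof.
move=> J iJ; have [i0 _ iM] := iJ.
have [[a Ja a0]|h] := pselect (exists2 a, J a & a != 0).
  exists [:: a] => [x|x _]; first by rewrite inE => /eqP->.
  move=> J' [_ _ iM'] h; rewrite -[x](mulfVK a0); apply: iM'.
  by apply: h; rewrite mem_head.
exists [::] => // x Jx J' [J'0 _ _] _.
have [->//|x0] := eqVneq x 0; by case: h; exists x.
Qed.

(* Hilbert's basis theorem, through the ideals of k-th coefficients of the
   elements of degree at most k. *)
Lemma noetherian_poly (R : comNzRingType) : noetherian R -> noetherian {poly R}.
Proof.
move=> nR J iJ; have [J0 JD JM] := iJ.
pose L k a := exists2 f : {poly R}, J f & (size f <= k.+1)%N /\ f`_k = a.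
have iL k : is_ideal (L k).
  split=> [|x y [f Jf [sf <-]] [g Jg [sg <-]]|a x [f Jf [sf <-]]].
  - by exists 0 => //; rewrite size_poly0 coef0.
  - exists (f + g); [exact: JD|split; last by rewrite coefD].
    by apply: leq_trans (size_polyD _ _) _; rewrite geq_max sf.
  exists (a%:P * f); [exact: JM|split; last by rewrite coefCM].
  by rewrite mul_polyC; apply: leq_trans (size_scale_leq _ _) _.
have LS k l a : (k <= l)%N -> L k a -> L l a.
  move=> /subnK <-; elim: (l - k)%N => // j IH /IH [f Jf [sf <-]].
  exists (f * 'X); first by rewrite mulrC; apply: JM.
  rewrite addSn coefMX /=; split=> //.
  have [->|f0] := eqVneq f 0; first by rewrite mul0r size_poly0.
  by rewrite size_mulX.
pose good k (t : seq {poly R}) := forall a, L k a -> exists2 g,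
  ideal_gen (fun y => y \in t) g & (size g <= k.+1)%N /\ g`_k = a.
have lift k : exists2 t : seq {poly R}, forall f, f \in t -> J f & good k t.
  have [s sL gL] := nR _ (iL k).
  have [t tJ ts] : exists2 t : seq {poly R}, forall f, f \in t -> J f &
      forall x, x \in s -> exists2 f, f \in t & (size f <= k.+1)%N /\ f`_k = x.
    elim: s sL {gL} => [|a s IH] sL; first by exists [::].
    have [|t tJ ts] := IH; first by move=> x xs; apply: sL; rewrite inE xs orbT.
    have [f Jf fP] := sL a (mem_head _ _); exists (f :: t) => x.
      by rewrite inE => /orP[/eqP->|/tJ].
    rewrite inE => /orP[/eqP->|/ts [g gt gP]]; first by exists f; rewrite ?mem_head.
    by exists g => //; rewrite inE gt orbT.
  pose Q b := exists2 g, ideal_gen (fun y => y \in t) g & (size g <= k.+1)%N /\ g`_k = b.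
  exists t => // a La; apply: (gL a La Q) => [|x /ts [f ft fP]]; last first.
    by exists f => //; apply: ideal_gen_mem.
  have [g0 gD gM] := ideal_gen_ideal (fun y => y \in t).
  split=> [|x y [f Jf [sf <-]] [g Jg [sg <-]]|b x [f Jf [sf <-]]].
  - by exists 0 => //; rewrite size_poly0 coef0.
  - exists (f + g); [exact: gD|split; last by rewrite coefD].
    by apply: leq_trans (size_polyD _ _) _; rewrite geq_max sf.
  exists (b%:P * f); [exact: gM|split; last by rewrite coefCM].
  by rewrite mul_polyC; apply: leq_trans (size_scale_leq _ _) _.
have lifts K : exists2 t : seq {poly R}, forall f, f \in t -> J f &
    forall k, (k <= K)%N -> good k t.
  elim: K => [|K [t tJ tg]].
    by have [t tJ tg] := lift 0%N; exists t => // k; rewrite leqn0 => /eqP->.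
  have [t' tJ' tg'] := lift K.+1; exists (t ++ t') => [f|k].
    by rewrite mem_cat => /orP[/tJ|/tJ'].
  rewrite leq_eqVlt => /orP[/eqP->|/tg tk] a.
    move=> /tg' [g gg gP]; exists g => //; apply: ideal_gen_sub gg => y yt.
    by rewrite mem_cat yt orbT.
  move=> /tk [g gg gP]; exists g => //; apply: ideal_gen_sub gg => y yt.
  by rewrite mem_cat yt.
(* Multiplication by ['X] makes the ideals [L k] increase, so their union is reached at some [K],
   and lifts for the indices up to [K] serve all higher degrees. *)
have [K LK] : exists K, forall k a, L k a -> L K a.
  have iU : is_ideal (fun a => exists k, L k a).
    split=> [|x y [k hx] [l hy]|a x [k hx]].
    - by exists 0%N; have [] := iL 0%N.
    - exists (maxn k l); have [_ iD _] := iL (maxn k l).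
      by apply: iD; [apply: LS hx; apply: leq_maxl|apply: LS hy; apply: leq_maxr].
    by exists k; have [_ _ iM] := iL k; apply: iM.
  have [s sU genU] := nR _ iU.
  have [K hK] : exists k, forall x, x \in s -> L k x.
    elim: s sU {genU} => [|a s IH] sU; first by exists 0%N.
    have [|k hk] := IH; first by move=> x xs; apply: sU; rewrite inE xs orbT.
    have [l hl] := sU a (mem_head _ _).
    exists (maxn k l) => x; rewrite inE => /orP[/eqP->|xs].
      by apply: LS hl; apply: leq_maxr.
    by apply: (LS k); [apply: leq_maxl | apply: hk].
  by exists K => k a Lka; apply: (genU a) => //; exists k.
have [t tJ tg] := lifts K; exists t => // f.
have [g0 gD gM] := ideal_gen_ideal (fun y => y \in t).
move: {2}(size f) (leqnn (size f)) => d; elim: d f => [|d IH] f sf Jf.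
  by move: sf; rewrite size_poly_leq0 => /eqP->.
have Lf : L d f`_d by exists f.
have [h gh [sh hd]] : exists2 h, ideal_gen (fun y => y \in t) h & (size h <= d.+1)%N /\ h`_d = f`_d.
  have [dK|/ltnW Kd] := leqP d K; first exact: tg Lf.
  have [h gh [sh hd]] := tg K (leqnn K) _ (LK _ _ Lf).
  exists ('X^(d - K) * h); first exact: gM.
  rewrite coefXnM ltnNge leq_subr /= subKn //; split=> //.
  apply: leq_trans (size_polyMleq _ _) _; rewrite size_polyXn /=.
  by rewrite -(subnK Kd) addnK -addnS leq_add2l.
have -> : f = (f - h) + h by rewrite subrK.
have Jh : J h by apply: gh => //.
apply: (gD) => //; apply: IH; last exact: idealB.
apply/leq_sizeP => j; rewrite leq_eqVlt coefB => /orP[/eqP<-|dj].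
  by rewrite hd subrr.
by rewrite !nth_default ?subr0 // ?(leq_trans sh) // (leq_trans sf).
Qed.

Lemma mpoly_ring_ind (R : nzRingType) n (P : {mpoly R[n]} -> Prop) :
  (forall c, P c%:MP) -> (forall i, P 'X_i) ->
  (forall p q, P p -> P q -> P (p + q)) ->
  (forall p q, P p -> P q -> P (p * q)) -> forall p, P p.
Proof.
move=> PC PX PD PM; elim/mpolyind => [|c m p _ _ Pp]; first by rewrite -mpolyC0.
apply: (PD) => //; rewrite -mul_mpolyC; apply: (PM) => //.
have P1 : P 1 by rewrite -mpolyC1.
rewrite mpolyXE_id; apply: (big_ind P P1 PM) => i _.
by elim: (m i) => [|k IH]; rewrite ?expr0 // exprS; apply: PM.
Qed.

Section MPolyAsPoly.
Variables (R : comNzRingType) (n : nat).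

Definition mpoly_of_poly : {rmorphism {poly {mpoly R[n]}} -> {mpoly R[n.+1]}} :=
  horner_eval 'X_ord_max \o map_poly (@mwiden n R).

Lemma mpoly_of_polyC p : mpoly_of_poly p%:P = mwiden p.
Proof. by rewrite /= /horner_eval map_polyC hornerC. Qed.

Lemma mpoly_of_poly_surj q : exists p, mpoly_of_poly p = q.
Proof.
elim/mpoly_ring_ind: q => [c|i|? ? [p <-] [q <-]|? ? [p <-] [q <-]].
- by exists (c%:MP)%:P; rewrite mpoly_of_polyC mwidenC.
- case: (unliftP ord_max i) => [j ->|->]; last first.
    by exists 'X; rewrite /= /horner_eval map_polyX hornerX.
  exists ('X_j)%:P; rewrite mpoly_of_polyC mwidenX mnmwiden1.
  by congr 'X_[U_( _)]; apply: val_inj; rewrite /= /bump leqNgt ltn_ord.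
- by exists (p + q); rewrite rmorphD.
by exists (p * q); rewrite rmorphM.
Qed.

End MPolyAsPoly.

Lemma noetherian_mpoly (F : fieldType) n : noetherian {mpoly F[n]}.
Proof.
elim: n => [|n IH].
  apply: (@noetherian_surj F _ (@mpolyC 0 F)); last exact: noetherian_field.
  move=> p; elim/mpoly_ring_ind: p => [c|[]//|? ? [p <-] [q <-]|? ? [p <-] [q <-]].
  - by exists c.
  - by exists (p + q); rewrite rmorphD.
  by exists (p * q); rewrite rmorphM.
apply: (@noetherian_surj {poly {mpoly F[n]}} _ (@mpoly_of_poly F n)); last exact: noetherian_poly.
exact: mpoly_of_poly_surj.
Qed.

(** * Nullstellensatz *)

Lemma exists_minimal (T : Type) (m : T -> nat) (Q : T -> Prop) :
  (exists x, Q x) -> exists2 x, Q x & forall y, Q y -> (m x <= m y)%N.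
Proof.
move=> [x]; move: {2}(m x) (leqnn (m x)) => k; elim: k x => [|k IH] x mx Qx.
  by exists x => // y _; move: mx; rewrite leqn0 => /eqP->.
have [[y Qy ym]|h] := pselect (exists2 y, Q y & (m y < m x)%N).
  by apply: (IH y) => //; rewrite -ltnS (leq_trans ym).
by exists x => // y Qy; rewrite leqNgt; apply/negP => ym; apply: h; exists y.
Qed.

Section RationalPoints.
Variable C : fieldType.
Hypothesis closedC : GRing.closed_field_axiom C.

Lemma closed_root (p : {poly C}) : (1 < size p)%N -> exists x, root p x.
Proof.
move=> sp; set l := lead_coef p.
have l0 : l != 0 by rewrite lead_coef_eq0 -size_poly_gt0 (ltn_trans _ sp).
have [|x xP] := @closedC (size p).-1 (fun i => - p`_i / l); first by rewrite -subn1 subn_gt0.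
exists x; rewrite /root horner_coef -(ltn_predK sp) big_ord_recr /= xP mulr_sumr -big_split /=.
apply/eqP/big1 => i _; rewrite -[p`_(size p).-1]/l mulNr mulNr mulrN mulrA mulrCA.
by rewrite divff // mulr1 subrr.
Qed.

(** A root of [p * 'X + 1] cannot be a root of [p]. *)
Lemma closed_nonroot (p : {poly C}) : p != 0 -> exists x, p.[x] != 0.
Proof.
move=> p0; have [|x] := @closed_root (p * 'X + 1%:P).
  by rewrite size_MXaddC (negbTE p0) /= ltnS size_poly_gt0.
move=> rx; exists x; apply: contraTneq rx => px.
by rewrite /root !hornerE px mul0r add0r oner_eq0.
Qed.

(* [h] is the structure map of the C-algebra [R]; for R finitely generated this
   is the Nullstellensatz. *)
Definition has_points (R : comNzRingType) (h : C -> R) :=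
  forall P, is_prime P -> forall f, ~ P f ->
  exists chi : {rmorphism R -> C},
    [/\ forall c, chi (h c) = c, forall p, P p -> chi p = 0 & chi f != 0].

(** A point of [R] killing the preimage of [P] kills the kernel of [f], so it factors through
    [S]. *)
Lemma has_points_surj (R S : comNzRingType) (h : C -> R) (f : {rmorphism R -> S}) :
  (forall y, exists x, f x = y) -> has_points h -> has_points (f \o h).
Proof.
move=> surj pR P pP s Ps.
have [g gK] := choice surj.
have [|chi [chih chiP chif]] := pR _ (prime_preim f pP) (g s); first by rewrite gK.
have [[P0 PD PM] P1 _] := pP.
have ker x y : f x = f y -> chi x = chi y.
  move=> e; apply/eqP; rewrite -subr_eq0 -rmorphB; apply/eqP/chiP.
  by rewrite rmorphB e subrr.
have add : zmod_morphism (chi \o g).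
  by move=> x y /=; rewrite -rmorphB; apply: ker; rewrite rmorphB !gK.
have mul : monoid_morphism (chi \o g).
  split=> [|x y] /=; last by rewrite -rmorphM; apply: ker; rewrite rmorphM !gK.
  by rewrite -(rmorph1 chi); apply: ker; rewrite rmorph1 gK.
pose bA := GRing.isZmodMorphism.Build S C (chi \o g) add.
pose bM := GRing.isMonoidMorphism.Build S C (chi \o g) mul.
pose psi : {rmorphism S -> C} := HB.pack (chi \o g) bA bM.
exists psi; split=> [c|p Pp|//] /=.
  by rewrite -[RHS]chih; apply: ker; rewrite gK.
by apply: chiP; rewrite gK.
Qed.

Lemma has_points_base : has_points (@id C).
Proof.
move=> P [[P0 PD PM] P1 _] f Pf; exists idfun; split=> //= [p Pp|].
  apply/eqP/negPn/negP => p0; apply: P1.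
  by rewrite -(mulVf p0); apply: PM.
by apply/eqP => f0; apply: Pf; rewrite f0.
Qed.

Section Poly.
Variables (R : comNzRingType) (P : {poly R} -> Prop).
Hypothesis pP : is_prime P.

(** Congruence modulo [coefsP], the ideal P0[X], stands for equality of polynomials over the domain
    R/P0. *)
Let P0 a := P a%:P.
Let coefsP (p : {poly R}) := forall i, P0 p`_i.

Let iP : is_ideal P. Proof. by case: pP. Qed.
Let pP0 : is_prime P0. Proof. exact: (prime_preim (@polyC R) pP). Qed.
Let iP0 : is_ideal P0. Proof. by case: pP0. Qed.

Lemma coefs_prime p : coefsP p -> P p.
Proof.
move=> h; rewrite -[p]coefK poly_def; apply: (ideal_sum _ iP) => i _.
by rewrite -mul_polyC; apply: (idealMr _ iP); apply: h.
Qed.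

Lemma coefs_primeM p q : coefsP p -> coefsP (p * q).
Proof.
by move=> h i; rewrite coefM; apply: (ideal_sum _ iP0) => j _; apply: (idealMr _ iP0); apply: h.
Qed.

(** Leading terms with coefficient in [P0] are dropped until the leading coefficient survives modulo
    [P0], so that sizes measure degrees over R/P0. *)
Lemma truncate_coefs r : ~ coefsP r ->
  exists2 r' : {poly R}, (size r' <= size r)%N & coefsP (r - r') /\ ~ P0 (lead_coef r').
Proof.
have [P00 _ _] := iP0.
move: {2}(size r) (leqnn (size r)) => d; elim: d r => [|d IH] r.
  rewrite size_poly_leq0 => /eqP-> []; by move=> i; rewrite coef0.
move=> sr nr; have [Pl|nP] := pselect (P0 (lead_coef r)); last first.
  by exists r => //; split=> // i; rewrite subrr coef0.
have r0 : r != 0 by apply: contra_notN nr => /eqP-> i; rewrite coef0.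
pose r1 := r - lead_coef r *: 'X^((size r).-1).
have rr1 : coefsP (r - r1).
  move=> i; rewrite opprB addrC subrK coefZ coefXn; case: eqP => _; first by rewrite mulr1.
  by rewrite mulr0.
have s1 : (size r1 < size r)%N.
  rewrite -(prednK (_ : 0 < size r)%N) ?size_poly_gt0 // ltnS; apply/leq_sizeP => j.
  rewrite leq_eqVlt coefB coefZ coefXn => /orP[/eqP<-|ltj].
    by rewrite eqxx mulr1 subrr.
  rewrite (gtn_eqF ltj) mulr0 subr0 nth_default //.
  by rewrite -(prednK (_ : 0 < size r)%N) ?size_poly_gt0.
have [||r' sr' [h nP]] := IH r1; first by rewrite -ltnS (leq_trans s1).
  move=> h; apply: nr => i; have [_ PD _] := iP0.
  have := rr1 i; rewrite coefB => hi; rewrite -(subrK r1`_i r`_i); exact: PD.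
exists r'; first exact: leq_trans sr' (ltnW s1).
split=> // i; have [_ PD _] := iP0.
by rewrite coefB -(subrKA r1`_i) -!coefB; apply: PD; [apply: rr1|apply: h].
Qed.

Lemma lead_not_prime (p : {poly R}) : ~ P0 (lead_coef p) -> p != 0.
Proof.
by have [P00 _ _] := iP0; apply: contra_notN => /eqP->; rewrite lead_coef0.
Qed.

Lemma pseudo_div (p q : {poly R}) : ~ P0 (lead_coef q) ->
  exists k a r, [/\ (lead_coef q ^+ k)%:P * p = a * q + r, (size r < size q)%N
                  & ~ P0 (lead_coef q ^+ k)].
Proof.
move=> nq; exists (Pdiv.Ring.rscalp p q), (Pdiv.Ring.rdivp p q), (Pdiv.Ring.rmodp p q).
split; first by rewrite mul_polyC Pdiv.ComRing.rdivp_eq.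
  by rewrite Pdiv.Ring.ltn_rmodp lead_not_prime.
by move/(prime_exp pP0).
Qed.

(* Over the fraction field of R/P0, the prime P becomes principal, generated
   by g, and f is invertible modulo g. *)
Lemma prime_generator f : ~ P f -> ~ (forall p, P p -> coefsP p) ->
  exists g b u, [/\ P g, ~ P0 (lead_coef g), (1 < size g)%N,
    forall p, P p -> exists k a r, (lead_coef g ^+ k)%:P * p = a * g + r /\ coefsP r &
    ~ P0 b /\ P (b%:P - u * f)].
Proof.
have [P00 PD0 PM0] := iP0; have [Pz PD PM] := iP; have [_ P1 prP] := pP.
move=> nPf alg.
have [g [Pg lg] gmin] : exists2 g : {poly R}, P g /\ ~ P0 (lead_coef g) &
    forall r : {poly R}, P r /\ ~ P0 (lead_coef r) -> (size g <= size r)%N.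
  apply: exists_minimal; apply: contrapT => h; apply: alg => p Pp.
  apply: contrapT => /truncate_coefs [p' _ [hp np]]; apply: h; exists p'; split=> //.
  by rewrite -(subKr p p'); apply: idealB => //; apply: coefs_prime.
have {}gmin (r : {poly R}) : P r -> (size r < size g)%N -> coefsP r.
  move=> Pr sr; apply: contrapT => /truncate_coefs [r' sr' [hr nr]].
  have /gmin : P r' /\ ~ P0 (lead_coef r').
    by split=> //; rewrite -(subKr r r'); apply: idealB => //; apply: coefs_prime.
  by rewrite leqNgt (leq_ltn_trans sr' sr).
have sg : (1 < size g)%N.
  rewrite ltnNge; apply/negP => /size1_polyC eg.
  by apply: lg; rewrite eg lead_coefC /P0 -eg.
(* Candidates for [b]: multiples of [f] modulo [P] that lie outside [P]. One of least size turns out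
   to be constant. *)
pose Q (h : {poly R}) := [/\ ~ P h, ~ P0 (lead_coef h) & exists u, P (h - u * f)].
have QE (r v : {poly R}) : ~ P r -> P (r - v * f) -> exists2 r' : {poly R}, Q r' & (size r' <= size r)%N.
  move=> nPr Pv; have [|r' sr' [hr nr]] := @truncate_coefs r; first by move/coefs_prime.
  have Prr := coefs_prime hr.
  exists r' => //; split=> //.
    by move=> Pr'; apply: nPr; rewrite -(subrK r' r); apply: PD.
  by exists v; rewrite -(subrKA r); apply: PD => //; rewrite -opprB; apply: idealN.
have [h [nPh lh [u Pu]] hmin] : exists2 h : {poly R}, Q h & forall h' : {poly R}, Q h' -> (size h <= size h')%N.
  apply: exists_minimal; have [|h Qh _] := QE f 1 nPf; last by exists h.
  by rewrite mul1r subrr.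
have shg : (size h < size g)%N.
  have [k [a [r]]] := pseudo_div h lg; set l := lead_coef _ ^+ k => [] [e sr nl].
  have nPr : ~ P r.
    move=> Pr; have : P (l%:P * h) by rewrite e; apply: PD => //; apply: PM.
    by case/prP.
  have [|r' Qr' sr'] := QE r (l%:P * u) nPr; last first.
    exact: leq_ltn_trans (hmin _ Qr') (leq_ltn_trans sr' sr).
  have -> : r - l%:P * u * f = l%:P * (h - u * f) - a * g.
    by rewrite mulrBr e mulrA addrAC [a * g + r]addrC addrK.
  by apply: idealB => //; apply: PM.
have sh : size h = 1%N.
  (* Pseudo-dividing [g] by a nonconstant [h] leaves a remainder in [P] by minimality of [h], hence
     a quotient [a] in [P]. If [a] is zero modulo [P0], so is the leading term of [l * g]; otherwise
     [a] has at least the degree of [g], and the leading term of [a * h] has nothing to cancel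
     it. *)
  apply/eqP; rewrite eqn_leq size_poly_gt0 (lead_not_prime lh) andbT leqNgt; apply/negP => sh.
  have [k [a [r]]] := pseudo_div g lh; set l := lead_coef _ ^+ k => [] [e sr nl].
  have srg := ltn_trans sr shg.
  have [Pr|nPr] := pselect (P r); last first.
    have [|r' Qr' sr'] := QE r (- a * u) nPr; last first.
      by have := hmin _ Qr'; rewrite leqNgt (leq_ltn_trans sr' sr).
    have -> : r - - a * u * f = l%:P * g - a * (h - u * f).
      by rewrite e; ring.
    by apply: idealB => //; apply: PM.
  have Pa : P a.
    have : P (a * h) by rewrite -(addrK r (a * h)) -e; apply: idealB => //; apply: PM.
    by case/prP.
  have ah j : (a * h)`_j = l * g`_j - r`_j by rewrite -coefCM e coefD addrK.
  have [ca|/truncate_coefs [a' _ [ha na]]] := pselect (coefsP a).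
    have := coefs_primeM h ca (size g).-1; rewrite ah.
    rewrite (nth_default 0 (_ : size r <= (size g).-1)%N); last by rewrite -ltnS (ltn_predK sg).
    rewrite subr0 => Plg; have {}Plg : P0 (l * lead_coef g) by exact: Plg.
    by case: pP0 => _ _ pr; case/pr: Plg.
  have sa' : (size g <= size a')%N.
    rewrite leqNgt; apply/negP => /gmin ga; apply: na; apply: ga.
    by rewrite -(subKr a a'); apply: idealB => //; apply: coefs_prime.
  have := coefs_primeM h ha ((size a').-1 + (size h).-1)%N.
  rewrite mulrBl coefB ah.
  have big : (size g <= (size a').-1 + (size h).-1)%N by lia.
  rewrite (nth_default 0 big) (nth_default 0 (leq_trans (ltnW srg) big)) mulr0 subr0 sub0r.
  have -> : ((size a').-1 + (size h).-1 = (size a' + size h).-2)%N by lia.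
  move=> /(idealN iP0); rewrite opprK -mul_lead_coef => Plh.
  have {}Plh : P0 (lead_coef a' * lead_coef h) by exact: Plh.
  by case: pP0 => _ _ pr; case/pr: Plh.
have eh : h = (lead_coef h)%:P by rewrite lead_coefE sh; apply/size1_polyC; rewrite sh.
exists g, (lead_coef h), u; split=> //; last by split=> //; rewrite -eh.
move=> p Pp; have [k [a [r [e sr _]]]] := pseudo_div p lg.
exists k, a, r; split=> //; apply: gmin => //.
have -> : r = (lead_coef g ^+ k)%:P * p - a * g by rewrite e addrC addKr.
by apply: idealB => //; apply: PM.
Qed.

End Poly.

(** If [P] is P0[X], a point of [R] not killing some coefficient of [f] extends by any value at
    which the specialised [f] is nonzero. Otherwise the point is chosen with [b] and the leading
    coefficient of [g] nonzero: [g] keeps its degree and has a root, which kills [P], and [f] stays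
    nonzero because it divides [b] modulo [P]. *)
Lemma has_points_poly (R : comNzRingType) (h : C -> R) :
  has_points h -> has_points (@polyC R \o h).
Proof.
move=> pR P pP f nPf; have [iP _ prP] := pP; have [_ PD PM] := iP.
have [_ _ prP0] := prime_preim (@polyC R) pP.
have [alg|nalg] := pselect (forall p : {poly R}, P p -> forall i, P (p`_i)%:P).
  have [i nfi] : exists i, ~ P (f`_i)%:P.
    by apply: contrapT => h'; apply/nPf/(coefs_prime pP) => i; apply: contrapT => nfi; apply: h'; exists i.
  have [chi [chih chiP chif]] := pR _ (prime_preim (@polyC R) pP) _ nfi.
  have [|x fx] := @closed_nonroot (map_poly chi f).
    by apply: contraNneq chif => f0; rewrite -coef_map f0 coef0.
  exists (horner_eval x \o map_poly chi); split=> // [c|p Pp] /=; rewrite /horner_eval.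
    by rewrite map_polyC hornerC /= chih.
  rewrite [map_poly _ _](_ : _ = 0) ?horner0 //; apply/polyP => j.
  by rewrite coef_map coef0; apply: chiP; apply: alg.
have [g [b [u [Pg lg sg divg [nb Pb]]]]] := prime_generator pP nPf nalg.
have nbl : ~ P (b * lead_coef g)%:P by rewrite polyCM => /prP [].
have [chi [chih chiP chibl]] := pR _ (prime_preim (@polyC R) pP) _ nbl.
have [chib chil] : chi b != 0 /\ chi (lead_coef g) != 0.
  by apply/andP; rewrite -negb_or -mulf_eq0 -rmorphM.
have [|x rx] := @closed_root (map_poly chi g); first by rewrite size_map_poly_id0.
pose psi : {rmorphism {poly R} -> C} := horner_eval x \o map_poly chi.
have psiC a : psi a%:P = chi a by rewrite /= /horner_eval map_polyC hornerC.
have psiP p : P p -> psi p = 0.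
  move=> /divg [k [a [r [e cr]]]]; apply/eqP.
  have /eqP : psi (lead_coef g ^+ k)%:P * psi p = 0.
    rewrite -rmorphM e rmorphD rmorphM [psi g](eqP rx) mulr0 add0r /= /horner_eval.
    rewrite [map_poly _ _](_ : _ = 0) ?horner0 //; apply/polyP => j.
    by rewrite coef_map coef0; apply: chiP; apply: cr.
  by rewrite psiC rmorphXn mulf_eq0 expf_eq0 (negbTE chil) andbF.
exists psi; split=> [c|//|]; first by rewrite -[RHS]chih -psiC.
apply: contraNneq chib => f0; have := psiP _ Pb.
by rewrite rmorphB rmorphM f0 mulr0 subr0 psiC => ->.
Qed.

Lemma has_points_mpoly n : has_points (@mpolyC n C).
Proof.
elim: n => [|n IH].
  apply: (has_points_surj (f := @mpolyC 0 C)) has_points_base.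
  move=> p; elim/mpoly_ring_ind: p => [c|[]//|? ? [p <-] [q <-]|? ? [p <-] [q <-]].
  - by exists c.
  - by exists (p + q); rewrite rmorphD.
  by exists (p * q); rewrite rmorphM.
have := has_points_surj (@mpoly_of_poly_surj C n) (has_points_poly IH).
congr has_points; apply/funext => c /=.
by rewrite /horner_eval map_polyC hornerC /= mwidenC.
Qed.

Lemma nullstellensatz n (P : {mpoly C[n]} -> Prop) (f : {mpoly C[n]}) :
  is_prime P -> ~ P f ->
  exists c : 'I_n -> C, (forall p, P p -> p.@[c] = 0) /\ f.@[c] != 0.
Proof.
move=> pP /(has_points_mpoly pP) [chi [chih chiP chif]].
exists (fun i => chi 'X_i); have E p : chi p = p.@[fun i => chi 'X_i].
  elim/mpoly_ring_ind: p => [c|i|p q ep eq|p q ep eq].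
  - by rewrite mevalC chih.
  - by rewrite mevalXU.
  - by rewrite rmorphD mevalD ep eq.
  by rewrite rmorphM mevalM ep eq.
by split=> [p /chiP|]; rewrite -E.
Qed.

End RationalPoints.

(** * Linear independence over a subfield *)

Section LinearIndependence.
Variables (F L : fieldType) (g : {rmorphism F -> L}).

Definition lin_indep r (e : 'I_r -> L) :=
  forall b : 'I_r -> F, \sum_k g (b k) * e k = 0 -> forall k, b k = 0.

(** A spanning family of least size is independent, since a nontrivial relation eliminates one
    member. *)
Lemma finite_basis (I : finType) (v : I -> L) :
  exists r (e : 'I_r -> L) (B : I -> 'I_r -> F),
    lin_indep e /\ forall i, v i = \sum_k g (B i k) * e k.
Proof.
pose Q (re : {r & 'I_r -> L}) :=
  exists B : I -> 'I_(tag re) -> F, forall i, v i = \sum_k g (B i k) * tagged re k.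
have [[r e] [B vB] rmin] : exists2 re, Q re & forall re', Q re' -> (tag re <= tag re')%N.
  apply: exists_minimal; exists (Tagged (fun r => 'I_r -> L) (fun k : 'I_#|I| => v (enum_val k))).
  exists (fun i k => (enum_rank i == k)%:R) => i /=.
  rewrite (bigD1 (enum_rank i)) //= eqxx rmorph1 mul1r enum_rankK big1 ?addr0 // => k.
  by rewrite eq_sym => /negbTE->; rewrite rmorph0 mul0r.
exists r, e, B; split=> // b b0 k0; apply/eqP/negPn/negP => bk0.
case: r => [|r] in e B vB rmin b b0 k0 bk0 *; first by have := ltn_ord k0.
pose e' := fun k : 'I_r => e (lift k0 k).
have := rmin (Tagged (fun r => 'I_r -> L) e'); rewrite /= ltnn => /(_ _)/negP[]//.
exists (fun i k => B i (lift k0 k) - B i k0 / b k0 * b (lift k0 k)) => i /=.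
rewrite vB (bigD1_ord k0) //=.
have ek0 : g (b k0) * e k0 = - \sum_(k < r) g (b (lift k0 k)) * e (lift k0 k).
  by apply/eqP; rewrite -addr_eq0; move: b0; rewrite (bigD1_ord k0) //= => ->.
have -> : g (B i k0) * e k0 = - \sum_(k < r) g (B i k0 / b k0 * b (lift k0 k)) * e (lift k0 k).
  have -> : g (B i k0) * e k0 = g (B i k0 / b k0) * (g (b k0) * e k0).
    by rewrite mulrA -rmorphM divfK.
  rewrite ek0 mulrN mulr_sumr; congr (- _); apply: eq_bigr => k _.
  by rewrite mulrA -rmorphM.
rewrite addrC -sumrB; apply: eq_bigr => k _.
by rewrite rmorphB mulrBl.
Qed.

Lemma mpoly_basis_expansion n (T : {mpoly L[n]}) :
  exists r (e : 'I_r -> L) (p : 'I_r -> {mpoly F[n]}),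
    [/\ lin_indep e, forall k, {subset msupp (p k) <= msupp T} &
        T = \sum_k e k *: map_mpoly g (p k)].
Proof.
pose m_ (i : 'I_(size (msupp T))) := nth 0%MM (msupp T) i.
have [r [e [B [ie eB]]]] := finite_basis (fun i => T@_(m_ i)).
exists r, e, (fun k => \sum_i B i k *: 'X_[m_ i]); split=> // [k m|].
  have : all (fun m' => m' \in msupp T) (msupp (\sum_i B i k *: 'X_[m_ i])); last by move/allP; apply.
  elim/big_ind: _ => [|p q /allP hp /allP hq|i _].
  - by rewrite msupp0.
  - by apply/allP => m' /msuppD_le; rewrite mem_cat => /orP[/hp|/hq].
  by apply/allP => m' /msuppZ_le; rewrite msuppX inE => /eqP->; apply: mem_nth.
rewrite {1}[T]mpolyE (big_nth 0%MM) big_mkord.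
under [RHS]eq_bigr do rewrite rmorph_sum scaler_sumr.
rewrite exchange_big /=; apply: eq_bigr => i _.
rewrite -/(m_ i) eB scaler_suml; apply: eq_bigr => k _.
by rewrite map_mpolyZ map_mpolyX scalerA mulrC.
Qed.

Lemma meval_map_mpoly n (p : {mpoly F[n]}) (c : 'I_n -> F) :
  (map_mpoly g p).@[fun i => g (c i)] = g p.@[c].
Proof.
elim/mpoly_ring_ind: p => [a|i|p q ep eq|p q ep eq].
- by rewrite map_mpolyC !mevalC.
- by rewrite map_mpolyX !mevalXU.
- by rewrite rmorphD !mevalD rmorphD ep eq.
by rewrite rmorphM !mevalM rmorphM ep eq.
Qed.

Lemma lin_indep_eq0 n r (e : 'I_r -> L) (p : 'I_r -> {mpoly F[n]}) (c : 'I_n -> F) :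
  lin_indep e ->
  (\sum_k e k *: map_mpoly g (p k)).@[fun i => g (c i)] = 0 <->
  forall k, (p k).@[c] = 0.
Proof.
move=> ie; rewrite raddf_sum /=.
under eq_bigr do rewrite mevalZ meval_map_mpoly mulrC.
by split=> [/ie //|h]; rewrite big1 // => k _; rewrite h rmorph0 mul0r.
Qed.

End LinearIndependence.

(* The minimal-support argument behind Artin's lemma, for several operators
   [phi] at once; it applies to [phi = der] and to [phi = sigma - id]. *)
Lemma span_of_invariants (L : fieldType) n (V : {mpoly L[n]} -> Prop)
    (O : (L -> L) -> Prop) (W : {mpoly L[n]} -> Prop) :
  (forall p q, V p -> V q -> V (p + q)) -> (forall a p, V p -> V (a *: p)) ->
  (forall phi, O phi -> phi 0 = 0 /\ phi 1 = 0) ->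
  (forall phi p q, O phi -> V p -> (forall m, q@_m = phi p@_m) -> V q) ->
  W 0 -> (forall p q, W p -> W q -> W (p + q)) -> (forall a p, W p -> W (a *: p)) ->
  (forall p, V p -> (forall phi m, O phi -> phi p@_m = 0) -> W p) ->
  forall p, V p -> W p.
Proof.
move=> VD VZ O01 VO W0 WD WZ WV p; move: {2}(size _) (leqnn (size (msupp p))) => d.
elim: d p => [|d IH] p sp Vp.
  by move: sp; rewrite leqn0 size_eq0 msupp_eq0 => /eqP->.
have [->//|p0] := eqVneq p 0.
pose Q q := [/\ V q, q != 0 & {subset msupp q <= msupp p}].
have [q [Vq q0 qp] qmin] :
    exists2 q, Q q & forall q', Q q' -> (size (msupp q) <= size (msupp q'))%N.
  by apply: exists_minimal; exists p; split.
have [m mq] : exists m, m \in msupp q.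
  case E: (msupp q) => [|m s]; last by exists m; rewrite mem_head.
  by move: q0; rewrite -msupp_eq0 E.
have qm0 : q@_m != 0 by rewrite -mcoeff_msupp.
(* Every [phi] kills the coefficient 1 at [m], so applying it to [q1] shrinks the support;
   minimality forces the result to be 0, and [q1] is invariant. *)
pose q1 := (q@_m)^-1 *: q.
have Vq1 : V q1 by apply: VZ.
have sq1 m' : (m' \in msupp q1) = (m' \in msupp q).
  by rewrite !mcoeff_msupp mcoeffZ mulf_eq0 invr_eq0 (negbTE qm0).
have q1m : q1@_m = 1 by rewrite mcoeffZ mulVf.
have Wq1 : W q1.
  apply: WV => // phi m' Ophi.
  have [phi0 phi1] := O01 _ Ophi.
  pose q2 : {mpoly L[n]} := \sum_(m <- msupp q1) phi q1@_m *: 'X_[m].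
  have q2E k : q2@_k = phi q1@_k.
    rewrite raddf_sum /=; have [kq|kq] := boolP (k \in msupp q1).
      rewrite (bigD1_seq k) ?msupp_uniq //= mcoeffZ mcoeffX eqxx mulr1 big1 ?addr0 //.
      by move=> j /negbTE jk; rewrite mcoeffZ mcoeffX jk mulr0.
    rewrite (memN_msupp_eq0 kq) phi0 big_seq big1 // => j jq.
    rewrite mcoeffZ mcoeffX; case: eqP => [jk|]; last by rewrite mulr0.
    by rewrite -jk jq in kq.
  rewrite -q2E; have [->|q20] := eqVneq q2 0; first by rewrite mcoeff0.
  have sq2 : {subset msupp q2 <= rem m (msupp q)}.
    move=> k; rewrite mem_rem_uniq ?msupp_uniq // !inE mcoeff_msupp q2E => h.
    apply/andP; split; first by apply: contra_neq h => ->; rewrite q1m.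
    rewrite -sq1 mcoeff_msupp; by apply: contra_neq h => ->.
  have /qmin : Q q2.
    by split=> //; [apply: (VO phi q1)|move=> k /sq2/mem_rem/qp].
  rewrite leqNgt (leq_ltn_trans (uniq_leq_size (msupp_uniq _) sq2)) //.
  by rewrite size_rem // prednK // -has_predT; apply/hasP; exists m.
have sp1 : {subset msupp (p - p@_m *: q1) <= rem m (msupp p)}.
  move=> k; rewrite mem_rem_uniq ?msupp_uniq // !inE mcoeff_msupp mcoeffB mcoeffZ => h.
  apply/andP; split; first by apply: contra_neq h => ->; rewrite q1m mulr1 subrr.
  apply: contraR h => kp; rewrite (memN_msupp_eq0 kp) sub0r oppr_eq0.
  rewrite (@memN_msupp_eq0 _ _ q1) ?mulr0 // sq1.
  by apply: contra kp => /qp.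
rewrite -(subrK (p@_m *: q1) p); apply: (WD); last exact: WZ.
apply: IH; last by rewrite -scaleNr; apply: VD => //; apply: VZ.
rewrite -ltnS; apply: leq_trans sp.
apply: leq_ltn_trans (uniq_leq_size (msupp_uniq _) sp1) _.
rewrite size_rem ?qp // prednK // -has_predT; apply/hasP; exists m => //; exact: qp.
Qed.

(** * Transcendence degree and growth of monomials *)

Section Support.
Variables (R : nzRingType) (n : nat).
Implicit Types (p q : {mpoly R[n]}) (m : 'X_{1..n}) (Q : 'X_{1..n} -> Prop).

Definition supp_in Q p := forall m, m \in msupp p -> Q m.

Lemma supp_in0 Q : supp_in Q 0.
Proof. by move=> m; rewrite mcoeff_msupp mcoeff0 eqxx. Qed.

Lemma supp_inD Q p q : supp_in Q p -> supp_in Q q -> supp_in Q (p + q).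
Proof.
by move=> hp hq m /msuppD_le; rewrite mem_cat => /orP[/hp|/hq].
Qed.

Lemma supp_inZ Q a p : supp_in Q p -> supp_in Q (a *: p).
Proof. by move=> hp m /msuppZ_le/hp. Qed.

Lemma supp_inX Q m : Q m -> supp_in Q 'X_[m].
Proof. by move=> Qm k; rewrite msuppX inE => /eqP->. Qed.

Lemma supp_in_sum Q (I : Type) (r : seq I) (P : pred I) (E : I -> {mpoly R[n]}) :
  (forall i, P i -> supp_in Q (E i)) -> supp_in Q (\sum_(i <- r | P i) E i).
Proof. by move=> h; apply: big_ind => //; [exact: supp_in0|exact: supp_inD]. Qed.

Lemma supp_inM Q1 Q2 Q p q :
  supp_in Q1 p -> supp_in Q2 q -> (forall m1 m2, Q1 m1 -> Q2 m2 -> Q (m1 + m2)%MM) ->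
  supp_in Q (p * q).
Proof.
by move=> hp hq h m /msuppM_le /allpairsP [[a b] /= [/hp ha /hq hb ->]]; apply: h.
Qed.

Lemma supp_in_sub Q1 Q2 p :
  (forall m, Q1 m -> Q2 m) -> supp_in Q1 p -> supp_in Q2 p.
Proof. by move=> h hp m /hp/h. Qed.

Lemma supp_in1 Q : Q 0%MM -> supp_in Q 1.
Proof. by move=> Q0 m; rewrite msupp1 inE => /eqP->. Qed.

Definition deg_le k := supp_in (fun m => (mdeg m <= k)%N).
Definition vars_in (S : pred 'I_n) := supp_in (fun m => forall i, ~~ S i -> m i = 0%N).

Lemma deg_leM k l p q : deg_le k p -> deg_le l q -> deg_le (k + l) (p * q).
Proof. by move=> hp hq; apply: supp_inM hp hq _ => a b ha hb; rewrite mdegD leq_add. Qed.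

Lemma deg_leW k l p : (k <= l)%N -> deg_le k p -> deg_le l p.
Proof. by move=> kl; apply: supp_in_sub => m mk; apply: leq_trans kl. Qed.

Lemma deg_le_exp k p d : deg_le k p -> deg_le (d * k) (p ^+ d).
Proof.
move=> hp; elim: d => [|d IH]; last by rewrite exprS mulSn; apply: deg_leM.
by rewrite expr0; apply: supp_in1; rewrite mdeg0.
Qed.

Lemma deg_le_prod e (p : 'I_e -> {mpoly R[n]}) (k : 'I_e -> nat) :
  (forall i, deg_le (k i) (p i)) -> deg_le (\sum_i k i) (\prod_i p i).
Proof.
move=> h; elim/big_ind2: _ => // [|a b c d]; last exact: deg_leM.
by apply: supp_in1; rewrite mdeg0.
Qed.

Lemma deg_le_exists p : exists k, deg_le k p.
Proof. by exists (msize p) => m /msize_mdeg_lt/ltnW. Qed.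

Lemma deg_le_bound (I : finType) (p : I -> {mpoly R[n]}) :
  exists k, forall i, deg_le k (p i).
Proof.
have [k hk] := choice (fun i => deg_le_exists (p i)).
by exists (\max_i k i) => i; apply: deg_leW (hk i); apply: leq_bigmax.
Qed.

Lemma vars_inM S p q : vars_in S p -> vars_in S q -> vars_in S (p * q).
Proof.
by move=> hp hq; apply: supp_inM hp hq _ => a b ha hb i Si; rewrite mnmDE ha ?hb.
Qed.

End Support.

Lemma supp_in_map (R S : nzRingType) n (f : {additive R -> S}) Q (p : {mpoly R[n]}) :
  supp_in Q p -> supp_in Q (map_mpoly f p).
Proof.
move=> hp m; rewrite mcoeff_msupp mcoeff_map_mpoly => h; apply: hp.
by rewrite mcoeff_msupp; apply: contra_neq h => ->; rewrite raddf0.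
Qed.

Lemma linear_dependence (F : fieldType) n (I : finType) (s : seq 'X_{1..n})
    (q : I -> {mpoly F[n]}) :
  (size s < #|I|)%N -> (forall i, {subset msupp (q i) <= s}) ->
  exists2 c : I -> F, exists i, c i != 0 & \sum_i c i *: q i = 0.
Proof.
move=> sI qs; pose A : 'M[F]_(#|I|, size s) := \matrix_(i, j) (q (enum_val i))@_(nth 0%MM s j).
have : kermx A != 0.
  rewrite kermx_eq0 /row_free neq_ltn; apply/orP; left.
  exact: leq_ltn_trans (rank_leq_col _) sI.
move=> /rowV0Pn [v /sub_kermxP vA v0].
exists (fun i => v 0 (enum_rank i)).
  apply: contrapT => h; move/eqP: v0; apply; apply/rowP => j; rewrite mxE.
  by apply/eqP/negPn/negP => vj; apply: h; exists (enum_val j); rewrite enum_valK.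
apply/mpolyP => m; rewrite mcoeff0 raddf_sum /=.
have [ms|ms] := boolP (m \in s); last first.
  rewrite big1 // => i _; rewrite mcoeffZ (memN_msupp_eq0 (contra (qs i m) ms)) mulr0 //.
have mi : (index m s < size s)%N by rewrite index_mem.
have := congr1 (fun M : 'rV_ _ => M 0 (Ordinal mi)) vA; rewrite !mxE => vAm; rewrite -[RHS]vAm.
rewrite (reindex_onto enum_val enum_rank) => [|i _]; last exact: enum_rankK.
apply: eq_big => [j|j _]; first by rewrite enum_valK eqxx.
by rewrite mxE mcoeffZ enum_valK nth_index.
Qed.

Section Growth.
Variables (F : fieldType) (n : nat) (J : {mpoly F[n]} -> Prop).
Hypothesis pJ : is_prime J.
Implicit Types (S : pred 'I_n) (p q : {mpoly F[n]}).

Definition independent_vars S := forall p, vars_in S p -> J p -> p = 0.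

Definition max_independent_vars S :=
  independent_vars S /\
  forall i, ~~ S i -> exists p, [/\ vars_in (predU1 i S) p, J p & p != 0].

Lemma max_independent_vars_exists : exists S, max_independent_vars S.
Proof.
have [S indS Smax] : exists2 S : pred 'I_n, independent_vars S &
    forall S', independent_vars S' -> (n - #|S| <= n - #|S'|)%N.
  apply: (@exists_minimal _ (fun S : pred 'I_n => n - #|S|)%N).
  exists pred0 => p hp Jp; have e : p = (p@_0)%:MP.
    apply/mpolyP => m; rewrite mcoeffC; have [->|m0] := eqVneq m 0%MM; first by rewrite mulr1.
    rewrite mulr0; apply/memN_msupp_eq0/negP => /hp h; move/eqP: m0; apply.
    by apply/mnmP => i; rewrite h // mnm0E.
  have [p0|p0] := eqVneq p@_0 0; first by rewrite e p0 mpolyC0.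
  have [[_ _ JM] J1 _] := pJ; case: J1.
  by rewrite -mpolyC1 -(mulVf p0) mpolyCM -e; apply: JM.
exists S; split=> // i Si; apply: contrapT => h.
have /Smax : independent_vars (predU1 i S).
  by move=> p hp Jp; apply/eqP/negPn/negP => p0; apply: h; exists p.
have e : #|predU1 i S| = #|S|.+1 by rewrite cardU1 unfold_in Si.
by have := max_card (predU1 i S); rewrite card_ord e; lia.
Qed.

Variable S : pred 'I_n.
Hypothesis maxS : max_independent_vars S.

Lemma independent_not_in p : vars_in S p -> p != 0 -> ~ J p.
Proof. by move=> hp p0 Jp; move/eqP: p0; apply; case: maxS => + _; apply. Qed.

(* The monomials reached when a power of the common leading coefficient [f]
   is used to lower the exponents of the variables outside [S]. *)
Let box (D : 'I_n -> nat) k (m : 'X_{1..n}) :=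
  forall i, if S i then (m i <= k)%N else (m i < D i)%N.

(** A relation of ['X_i] over the variables in [S] is sorted by powers of ['X_i]: [f] is the
    coefficient of the highest power and [- r] the rest. Independence of [S] rules out [d = 0]. *)
Lemma leading_relation i : ~~ S i -> exists d f r,
  [/\ (0 < d)%N, vars_in S f, f != 0, J (f * 'X_i ^+ d - r) &
      supp_in (fun m => (m i < d)%N /\ forall j, ~~ S j -> j != i -> m j = 0%N) r].
Proof.
move=> Si; have [_ /(_ i Si) [p [hp Jp p0]]] := maxS.
have iJ : is_ideal J by case: pJ.
(* The exponent of ['X_i] is maximised by minimising its distance to [msize p], which exceeds every
   exponent, so the subtraction never truncates. *)
have [m0 m0p m0max] : exists2 m, m \in msupp p &
    forall m' : 'X_{1..n}, m' \in msupp p -> (msize p - m i <= msize p - m' i)%N.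
  apply: (@exists_minimal _ (fun m : 'X_{1..n} => msize p - m i)%N (fun m => m \in msupp p)).
  case E: (msupp p) => [|m s]; last by exists m; rewrite mem_head.
  by move: p0; rewrite -msupp_eq0 E.
pose d := m0 i.
have dm (m : 'X_{1..n}) : m \in msupp p -> (m i <= d)%N.
  move=> mp; have := m0max _ mp; rewrite -/d.
  have := msize_mdeg_lt mp; have : (m i <= mdeg m)%N.
    by rewrite mdegE (bigD1 i) //= leq_addr.
  by lia.
pose f : {mpoly F[n]} := \sum_(m <- msupp p | m i == d) p@_m *: 'X_[m - U_(i) *+ d].
pose r : {mpoly F[n]} := - \sum_(m <- msupp p | m i != d) p@_m *: 'X_[m].
have hr : supp_in (fun m => (m i < d)%N /\ forall j, ~~ S j -> j != i -> m j = 0%N) r.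
  rewrite /r -sumrN big_seq_cond; apply: supp_in_sum => m /andP[mp mi].
  rewrite -scaleNr; apply: supp_inZ; apply: supp_inX; split; first by rewrite ltn_neqAle mi dm.
  by move=> j Sj ji; apply: hp mp _ _; rewrite /= negb_or ji.
have pE : p = f * 'X_i ^+ d - r.
  rewrite opprK [LHS]mpolyE (bigID (fun m : 'X_{1..n} => m i == d)) /=; congr (_ + _).
  rewrite mulr_suml; apply: eq_bigr => m /eqP mi.
  rewrite -scalerAl mpolyXn -mpolyXD submK //.
  apply/mnm_lepP => j; rewrite mulmnE mnm1E; case: eqP => [<-|_]; last by [].
  by rewrite mul1n mi.
have hf : vars_in S f.
  rewrite /f big_seq_cond; apply: supp_in_sum => m /andP[mp /eqP mi].
  apply: supp_inZ; apply: supp_inX => j Sj; rewrite mnmBE mulmnE mnm1E.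
  have [<-|ij] := eqVneq i j; first by rewrite mul1n mi subnn.
  rewrite mul0n subn0; apply: hp mp _ _.
  by rewrite /= negb_or Sj eq_sym ij.
have f0 : f != 0.
  have : (p + r)@_m0 != 0.
    rewrite mcoeffD (memN_msupp_eq0 (_ : m0 \notin msupp r)) ?addr0 -?mcoeff_msupp //.
    by apply/negP => /hr []; rewrite ltnn.
  apply: contra_neq; rewrite pE subrK => ->; by rewrite mul0r mcoeff0.
exists d, f, r; split=> //; last by rewrite -pE.
rewrite lt0n; apply/negP => /eqP d0; move/eqP: p0; apply.
case: maxS => indS _; apply: indS Jp => m mp j Sj.
have [->|ji] := eqVneq j i; first by apply/eqP; rewrite -leqn0 -d0; apply: dm.
by apply: hp mp _ _; rewrite /= negb_or ji.
Qed.

(** Multiplying each relation by the leading coefficients of the others gives them all the same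
    leading coefficient [f], the product, which is outside [J] because [S] is independent. *)
Lemma reduction_data : exists (D : 'I_n -> nat) f (r : 'I_n -> {mpoly F[n]}) b,
  [/\ forall i, (0 < D i)%N, vars_in S f, ~ J f, deg_le b f &
    forall i, ~~ S i -> [/\ J (f * 'X_i ^+ D i - r i), deg_le b (r i) &
      supp_in (fun m => (m i < D i)%N /\ forall j, ~~ S j -> j != i -> m j = 0%N) (r i)]].
Proof.
have iJ : is_ideal J by case: pJ.
pose rel i (t : nat * {mpoly F[n]} * {mpoly F[n]}) :=
  let: (d, f, r) := t in
  [/\ (0 < d)%N, vars_in S f, f != 0 & ~~ S i -> J (f * 'X_i ^+ d - r) /\
    supp_in (fun m => (m i < d)%N /\ forall j, ~~ S j -> j != i -> m j = 0%N) r].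
have /choice [t tP] : forall i, exists t, rel i t.
  move=> i; case: (boolP (S i)) => Si.
    by exists (1%N, 1, 0); split=> //; [apply: supp_in1 => j _; rewrite mnm0E|exact: oner_neq0|rewrite Si].
  by have [d [f [r [d0 hf f0 Jf hr]]]] := leading_relation Si; exists (d, f, r); split.
pose D i := (t i).1.1; pose f_ i := (t i).1.2; pose r_ i := (t i).2.
have {}tP i : [/\ (0 < D i)%N, vars_in S (f_ i), f_ i != 0 &
    ~~ S i -> J (f_ i * 'X_i ^+ D i - r_ i) /\
    supp_in (fun m => (m i < D i)%N /\ forall j, ~~ S j -> j != i -> m j = 0%N) (r_ i)].
  by have := tP i; rewrite /rel /D /f_ /r_; case: (t i) => [[]].
pose f := \prod_i f_ i; pose r i := (\prod_(j | j != i) f_ j) * r_ i.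
have hprod P : vars_in S (\prod_(j | P j) f_ j).
  elim/big_ind: _ => [|p q|i _]; [|exact: vars_inM|by case: (tP i)].
  by apply: supp_in1 => j _; rewrite mnm0E.
have [b1 hb1] := deg_le_exists f; have [b2 hb2] := deg_le_bound r.
exists D, f, r, (maxn b1 b2); split=> [i|||| i Si]; first by case: (tP i).
- exact: hprod.
- apply: independent_not_in; first exact: hprod.
  by apply/prodf_neq0 => i _; case: (tP i).
- by apply: deg_leW hb1; apply: leq_maxl.
have [_ _ _ /(_ Si) [Jf hr]] := tP i; split.
- rewrite /f (bigD1 i) //= /r mulrAC -[X in _ - X]mulrC -mulrBl mulrC.
  by case: iJ => _ _; apply.
- by apply: deg_leW (hb2 i); apply: leq_maxr.
apply: supp_inM (hprod _) hr _ => m1 m2 h1 [h2 h3]; split; first by rewrite mnmDE h1.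
by move=> j Sj ji; rewrite mnmDE h1 ?h3.
Qed.

Lemma mpoly_supp_ind (Q : 'X_{1..n} -> Prop) (P : {mpoly F[n]} -> Prop) :
  P 0 -> (forall p q, P p -> P q -> P (p + q)) -> (forall a p, P p -> P (a *: p)) ->
  (forall m, Q m -> P 'X_[m]) -> forall p, supp_in Q p -> P p.
Proof.
move=> P0 PD PZ PX p hp; rewrite [p]mpolyE big_seq.
by apply: (big_ind P) => // m mp; apply/PZ/PX/hp.
Qed.

(** One factor [f] is spent per variable: if multiplying by ['X_i] brings an exponent outside [S] up
    to [D i], the relation for [f * 'X_i ^+ D i] lowers it. With [b] bounding the degrees of [f] and
    the [r i], a step raises the exponents in [S] by at most [b.+1], the extra one being for the
    variable itself. *)
Lemma reduce_to_box : exists (D : 'I_n -> nat) f b, [/\ forall i, (0 < D i)%N, ~ J f &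
  forall k p, deg_le k p -> exists2 q, supp_in (box D (b * k)) q & J (f ^+ k * p - q)].
Proof.
have iJ : is_ideal J by case: pJ.
have [J0 JD JM] := iJ.
have [D [f [r [b [D0 hf nJf bf hr]]]]] := reduction_data.
exists D, f, b.+1; split=> //.
pose red k (g p : {mpoly F[n]}) := exists2 q, supp_in (box D k) q & J (g * p - q).
have red0 k g : red k g 0 by exists 0; [exact: supp_in0|rewrite mulr0 subrr].
have redD k g p q : red k g p -> red k g q -> red k g (p + q).
  move=> [p' hp Jp] [q' hq Jq]; exists (p' + q'); first exact: supp_inD.
  by rewrite mulrDr opprD addrACA; apply: JD.
have redZ k g a p : red k g p -> red k g (a *: p).
  move=> [p' hp Jp]; exists (a *: p'); first exact: supp_inZ.
  by rewrite -scalerAr -scalerBr -mul_mpolyC; apply: JM.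
have stepf k q : supp_in (box D k) q -> red (b.+1 + k)%N f q.
  move=> hq; exists (f * q); last by rewrite subrr.
  apply: (supp_inM (Q1 := fun m => (forall i, ~~ S i -> m i = 0%N) /\ (mdeg m <= b)%N)) hq _.
    by move=> m mf; split; [exact: hf|exact: bf].
  move=> m1 m2 [h1 d1] h2 i; have := h2 i; rewrite mnmDE; case: ifP => Si h; last by rewrite h1 ?Si.
  have : (m1 i <= mdeg m1)%N by rewrite mdegE (bigD1 i) //= leq_addr.
  by lia.
have stepX k i q : supp_in (box D k) q -> red (b.+1 + k)%N (f * 'X_i) q.
  apply: mpoly_supp_ind => [|p1 p2|a p1|m hm]; [exact: red0|exact: redD|exact: redZ|].
  have [/andP[Si mi]|hi] := boolP (~~ S i && ((m i).+1 == D i)).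
    have [Jr br sr] := hr i Si.
    exists (r i * 'X_[m - U_(i) *+ m i]).
      apply: (@supp_inM _ _ (fun m => [/\ (mdeg m <= b)%N, (m i < D i)%N & forall j, ~~ S j -> j != i -> m j = 0%N])
                (eq (m - U_(i) *+ m i)%MM)).
      - by move=> m' hm'; have [] := sr _ hm'; split=> //; apply: br.
      - exact: supp_inX.
      move=> m1 _ [d1 h1 h2] <- j; rewrite mnmDE mnmBE mulmnE mnm1E.
      have := hm j; case: ifP => Sj hj.
        have : (m1 j <= mdeg m1)%N by rewrite mdegE (bigD1 j) //= leq_addr.
        by move: hj; case: eqP => _; lia.
      have [<-|ij] := eqVneq i j; first by rewrite mul1n subnn addn0.
      by rewrite h2 ?Sj 1?eq_sym // mul0n subn0.
    have -> : 'X_[m] = 'X_i ^+ (m i) * 'X_[m - U_(i) *+ m i] :> {mpoly F[n]}.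
      rewrite mpolyXn -mpolyXD addmC submK //.
      apply/mnm_lepP => j; rewrite mulmnE mnm1E; case: eqP => [<-|_]; last by [].
      by rewrite mul1n.
    rewrite -mulrA (mulrA 'X_i) -exprS (eqP mi) mulrA -mulrBl mulrC; exact: JM.
  exists (f * 'X_i * 'X_[m]); last by rewrite subrr.
  rewrite -mulrA -mpolyXD.
  apply: (supp_inM (Q1 := fun m => (forall i, ~~ S i -> m i = 0%N) /\ (mdeg m <= b)%N)
                   (Q2 := eq (U_(i) + m)%MM)).
  - by move=> m' mf; split; [exact: hf|exact: bf].
  - exact: supp_inX.
  move=> m1 _ [h1 d1] <- j; rewrite !mnmDE mnm1E.
  have := hm j; case: ifP => Sj hj.
    have : (m1 j <= mdeg m1)%N by rewrite mdegE (bigD1 j) //= leq_addr.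
    by move: hj; case: eqP => _; lia.
  rewrite h1 ?Sj // add0n; have [ij|_] := eqVneq i j; last by [].
  by move: hi hj; rewrite ij Sj /=; lia.
elim=> [|k IH] p.
  move=> hp; rewrite muln0; suff : red 0%N (f ^+ 0) p by [].
  apply: mpoly_supp_ind hp => [|p1 p2|a p1|m]; [exact: red0|exact: redD|exact: redZ|].
  rewrite leqn0 mdeg_eq0 => /eqP->; exists 1; last by rewrite expr0 mul1r mpolyX0 subrr.
  by apply: supp_in1 => i; rewrite mnm0E; case: ifP.
move=> hp; rewrite mulnS; suff : red (b.+1 + b.+1 * k)%N (f ^+ k.+1) p by [].
apply: mpoly_supp_ind hp => [|p1 p2|a p1|m hm]; [exact: red0|exact: redD|exact: redZ|].
have [mk|km] := leqP (mdeg m) k.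
  have [q hq Jq] := IH _ (@supp_inX F n (fun m => (mdeg m <= k)%N) _ mk).
  have [q' hq' Jq'] := stepf _ _ hq; exists q' => //.
  have -> : f ^+ k.+1 * 'X_[m] - q' = f * (f ^+ k * 'X_[m] - q) + (f * q - q') by rewrite exprS; ring.
  by apply: (JD) => //; apply: JM.
have [i mi] : exists i, (0 < m i)%N.
  apply: contrapT => h; move: km; rewrite mdegE big1 // => i _; apply/eqP.
  by rewrite -leqn0 leqNgt; apply/negP => ?; apply: h; exists i.
have em : m = (m - U_(i) + U_(i))%MM.
  by rewrite submK //; apply/mnm_lepP => j; rewrite mnm1E; case: eqP => [<-|].
have mk : (mdeg (m - U_(i)) <= k)%N.
  by rewrite -ltnS (leq_trans _ hm) // {2}em mdegD mdeg1 addn1.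
have [q hq Jq] := IH _ (@supp_inX F n (fun m => (mdeg m <= k)%N) _ mk).
have [q' hq' Jq'] := stepX _ i _ hq; exists q' => //.
have -> : f ^+ k.+1 * 'X_[m] - q' =
    f * 'X_i * (f ^+ k * 'X_[m - U_(i)] - q) + (f * 'X_i * q - q').
  by rewrite {1}em mpolyXD exprS; ring.
by apply: (JD) => //; apply: JM.
Qed.

(* The number of monomials of degree at most k modulo J grows like k ^ #|S|,
   so it is outgrown by any family with more exponents. *)
Lemma growth_dependence e B : (#|S| < e)%N ->
  exists m, forall W : {ffun 'I_e -> 'I_m} -> {mpoly F[n]},
    (forall x, deg_le (B * m) (W x)) ->
    exists2 c : {ffun 'I_e -> 'I_m} -> F, exists x, c x != 0 & J (\sum_x c x *: W x).
Proof.
move=> Se; have [D [f [b [D0 nJf red]]]] := reduce_to_box.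
have iJ : is_ideal J by case: pJ.
pose c := (\prod_(i | ~~ S i) D i)%N.
(* The box for degree [B * m] holds [c * (b * B * m + 1) ^ #|S|] monomials, at most
   [c * (b * B + 1) ^ #|S| * m ^ #|S|]. This [m] makes that less than [m ^ #|S|.+1], hence less than
   [m ^ e], the number of the [W x]. *)
pose m := (c * (b * B + 1) ^ #|S|).+1; exists m => W hW.
have /choice [q qP] : forall x, exists q, supp_in (box D (b * (B * m))) q /\ J (f ^+ (B * m) * W x - q).
  by move=> x; have [q ? ?] := red _ _ (hW x); exists q.
pose bnd i := if S i then (b * (B * m)).+1 else D i.
pose s := [seq [multinom (g i : nat) | i < n] | g : {dffun forall i : 'I_n, 'I_(bnd i)}].
have sbox k : box D (b * (B * m)) k -> k \in s.
  move=> hk; have kb i : (k i < bnd i)%N by have := hk i; rewrite /bnd; case: ifP.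
  apply/mapP; exists [ffun i => Ordinal (kb i)]; first by rewrite mem_enum.
  by apply/mnmP => i; rewrite mnmE ffunE.
have ssize : (size s < #|{ffun 'I_e -> 'I_m}|)%N.
  rewrite size_map -cardE card_dep_ffun card_ffun !card_ord foldrE big_image /=.
  under eq_bigr do rewrite card_ord.
  rewrite (bigID S) /= (eq_bigr (fun=> (b * (B * m)).+1)) => [|i Si]; last by rewrite /bnd Si.
  rewrite [X in (_ * X)%N](eq_bigr D) => [|i /negbTE Si]; last by rewrite /bnd Si.
  rewrite -/c prod_nat_const.
  have h1 : ((b * (B * m)).+1 <= (b * B + 1) * m)%N by rewrite mulnDl mul1n mulnA /m; lia.
  have h2 : ((b * (B * m)).+1 ^ #|S| * c <= (b * B + 1) ^ #|S| * m ^ #|S| * c)%N.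
    rewrite leq_mul2r -expnMn; apply/orP; right.
    by elim: #|S| => // k IH; rewrite !expnS leq_mul.
  apply: leq_ltn_trans h2 _; apply: leq_trans (_ : m ^ #|S|.+1 <= _)%N; last by rewrite leq_pexp2l.
  rewrite mulnAC expnS ltn_pmul2r ?expn_gt0 //.
  by rewrite mulnC.
have [|c0 [x cx] ce] := linear_dependence ssize (q := q).
  by move=> x k kq; apply: sbox; case: (qP x) => + _; apply.
exists c0; first by exists x.
(* A dependence among the reduced forms [q x] puts a power of [f] times the combination of the [W x]
   in [J]; the power cancels since [J] is prime. *)
have Jprod : J (f ^+ (B * m) * \sum_x c0 x *: W x).
  rewrite -[X in J X](subrK (\sum_x c0 x *: q x)) {2}ce addr0 mulr_sumr -sumrB.
  apply: (ideal_sum _ iJ) => y _; rewrite -scalerAr -scalerBr -mul_mpolyC; case: iJ => _ _; apply; by case: (qP y).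
by have [_ _ pr] := pJ; case: (pr _ _ Jprod) => // /(prime_exp pJ).
Qed.

End Growth.

(** * Polynomials in the entries of a matrix *)

(** The preimages of [I] under the iterates of [theta] form an increasing chain, so two consecutive
    ones coincide; as [theta] is onto, so do [I] and its first preimage. This upgrades inclusions of
    ideals to equalities in [componentV] and [galois_mxP]. *)
Lemma stable_ideal_preim (R : comNzRingType) (I : R -> Prop)
    (theta theta' : {rmorphism R -> R}) :
  noetherian R -> cancel theta' theta -> is_ideal I ->
  (forall x, I x -> I (theta x)) -> forall x, I (theta x) -> I x.
Proof.
move=> nR thK iI Ith x Ix; pose J k y := I (iter k theta y).
have iterK k y : iter k theta (iter k theta' y) = y.
  by elim: k y => // k IH y; rewrite [iter k.+1 theta' y]iterSr iterS IH thK.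
have iJ k : is_ideal (J k).
  elim: k => [//|k IH]; rewrite /J.
  have := ideal_preim theta IH; congr is_ideal; apply/funext => y; by rewrite /J -iterSr.
have [_ [k ->] maxk] : exists2 J', (exists k, J' = J k) &
    forall J'', (exists k, J'' = J k) -> (forall x, J' x -> J'' x) -> forall x, J'' x -> J' x.
  apply: noetherian_maximal => // [J' [k ->] //|]; by exists (J 0%N), 0%N.
have := maxk (J k.+1) _ _ (iter k theta' x); rewrite /J iterK iterS iterK; apply=> //.
- by exists k.+1.
- by move=> y Jy; rewrite /= ; apply: Ith.
Qed.

Section MatrixEvaluation.
Variable n : nat.

Definition evm (F : nzRingType) (A : comNzRingType) (g : {rmorphism F -> A})
    (W : 'M[A]_n) : {rmorphism {mpoly F[n * n]} -> A} :=
  mmap g (fun k => mxvec W 0 k).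

Definition gen_mx (F : nzRingType) : 'M[{mpoly F[n * n]}]_n := vec_mx (\row_k 'X_k).

Section Theory.
Variables (F : nzRingType) (A : comNzRingType) (g : {rmorphism F -> A}).

Lemma evmC W c : evm g W c%:MP = g c.
Proof. exact: mmapC. Qed.

Lemma evmX W k : evm g W 'X_k = mxvec W 0 k.
Proof. by rewrite /evm /= mmapX mmap1U. Qed.

Lemma evmZ W c p : evm g W (c *: p) = g c * evm g W p.
Proof. exact: mmapZ. Qed.

Lemma evm_gen W : map_mx (evm g W) (gen_mx F) = W.
Proof.
apply: (can_inj mxvecK); rewrite -map_mxvec vec_mxK; apply/rowP => k.
by rewrite !mxE evmX.
Qed.

End Theory.

Lemma evm_comp (F : nzRingType) (A B : comNzRingType) (g : {rmorphism F -> A})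
    (phi : {rmorphism A -> B}) (h : {rmorphism F -> B})
    W p : (forall x, phi (g x) = h x) -> phi (evm g W p) = evm h (map_mx phi W) p.
Proof.
move=> gh; elim/mpoly_ring_ind: p => [c|k|p q ep eq|p q ep eq].
- by rewrite evmC [RHS]evmC gh.
- by rewrite evmX [RHS]evmX -map_mxvec mxE.
- by rewrite !rmorphD ep eq.
by rewrite !rmorphM ep eq.
Qed.

Lemma evm_map_mpoly (F : nzRingType) (L : comNzRingType) (g : {rmorphism F -> L}) W p :
  evm idfun W (map_mpoly g p) = evm g W p.
Proof.
elim/mpoly_ring_ind: p => [c|k|p q ep eq|p q ep eq].
- by rewrite map_mpolyC [LHS]evmC [RHS]evmC.
- by rewrite map_mpolyX [LHS]evmX [RHS]evmX.
- by rewrite !rmorphD ep eq.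
by rewrite !rmorphM ep eq.
Qed.

Lemma mx_evalE (C : fieldType) (p : {mpoly C[n * n]}) c : mx_eval p c = evm idfun c p.
Proof. by []. Qed.

Section Substitution.
Variable F : comNzRingType.
Implicit Types (V : 'M[{mpoly F[n * n]}]_n) (a : 'M[F]_n).

Definition subst_mx V : {rmorphism {mpoly F[n * n]} -> {mpoly F[n * n]}} :=
  evm (@mpolyC (n * n) F) V.

Lemma evm_subst (A : comNzRingType) (g : {rmorphism F -> A}) W V p :
  evm g W (subst_mx V p) = evm g (map_mx (evm g W) V) p.
Proof. by apply: evm_comp => x; rewrite evmC. Qed.

Definition subst_l a := subst_mx (map_mx (@mpolyC (n * n) F) a *m gen_mx F).
Definition subst_r a := subst_mx (gen_mx F *m map_mx (@mpolyC (n * n) F) a).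

Lemma map_evmC (A : comNzRingType) (g : {rmorphism F -> A}) W a :
  map_mx (evm g W) (map_mx (@mpolyC (n * n) F) a) = map_mx g a.
Proof. by apply/matrixP => i k; rewrite !mxE evmC. Qed.

Lemma evm_subst_l (A : comNzRingType) (g : {rmorphism F -> A}) W a p :
  evm g W (subst_l a p) = evm g (map_mx g a *m W) p.
Proof. by rewrite evm_subst map_mxM map_evmC evm_gen. Qed.

Lemma evm_subst_r (A : comNzRingType) (g : {rmorphism F -> A}) W a p :
  evm g W (subst_r a p) = evm g (W *m map_mx g a) p.
Proof. by rewrite evm_subst map_mxM map_evmC evm_gen. Qed.

Lemma evm_genE p : evm (@mpolyC (n * n) F) (gen_mx F) p = p.
Proof.
elim/mpoly_ring_ind: p => [c|k|p q ep eq|p q ep eq].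
- by rewrite evmC.
- by rewrite evmX vec_mxK mxE.
- by rewrite rmorphD ep eq.
by rewrite rmorphM ep eq.
Qed.

Lemma subst_l_comp a b p : a *m b = 1%:M -> subst_l b (subst_l a p) = p.
Proof.
move=> ab; rewrite [LHS]evm_subst_l mulmxA -map_mxM ab map_mx1 mul1mx.
exact: evm_genE.
Qed.

End Substitution.

Lemma subst_l_stable (F : fieldType) (I : {mpoly F[n * n]} -> Prop) (a : 'M[F]_n) :
  a \in unitmx -> is_ideal I -> (forall p, I p -> I (subst_l a p)) ->
  forall p, I (subst_l a p) -> I p.
Proof.
move=> ua iI; apply: (@stable_ideal_preim _ _ _ (subst_l (invmx a))) => //.
  exact: noetherian_mpoly.
by move=> p; apply: subst_l_comp; rewrite mulVmx.
Qed.

End MatrixEvaluation.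

(** * Identity component *)

Section IdentityComponent.
Variables (C : fieldType) (n : nat).
Implicit Types (X Y : set 'M[C]_n) (p q : {mpoly C[n * n]}).

Definition vanishes p Y := forall y, Y y -> mx_eval p y = 0.

(** Stated for arbitrary sets, without closedness, so that products of sets and one-point
    enlargements are covered directly. The empty set qualifies. *)
Definition irreducible_set Y :=
  forall p q, vanishes (p * q) Y -> vanishes p Y \/ vanishes q Y.

Lemma mx_evalM p q y : mx_eval (p * q) y = mx_eval p y * mx_eval q y.
Proof. exact: rmorphM. Qed.

Lemma mx_eval_subst_l a p y : mx_eval (subst_l a p) y = mx_eval p (a *m y).
Proof. by rewrite !mx_evalE evm_subst_l map_mx_id. Qed.

Lemma left_translate a : exists tr : {mpoly C[n * n]} -> {mpoly C[n * n]},
  forall p y, mx_eval (tr p) y = mx_eval p (a *m y).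
Proof. by exists (subst_l a) => p y; apply: mx_eval_subst_l. Qed.

Lemma right_translate a : exists tr : {mpoly C[n * n]} -> {mpoly C[n * n]},
  forall p y, mx_eval (tr p) y = mx_eval p (y *m a).
Proof.
by exists (subst_r a) => p y; rewrite !mx_evalE evm_subst_r map_mx_id.
Qed.

Lemma vanishing_is_ideal Y : is_ideal (vanishes^~ Y).
Proof.
split=> [y _|p q hp hq y Yy|a p hp y Yy]; rewrite mx_evalE.
- by rewrite rmorph0.
- by rewrite rmorphD -!mx_evalE hp // hq // addr0.
by rewrite rmorphM -!mx_evalE hp // mulr0.
Qed.

Lemma vanishing_is_prime Y y : Y y -> irreducible_set Y -> is_prime (vanishes^~ Y).
Proof.
move=> Yy iY; split; [exact: vanishing_is_ideal| |exact: iY].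
by move/(_ y Yy)/eqP; rewrite mx_evalE rmorph1 oner_eq0.
Qed.

Lemma not_vanishes p Y : ~ vanishes p Y -> exists2 y, Y y & mx_eval p y <> 0.
Proof.
by move=> h; apply: contrapT => h'; apply: h => y Yy; apply: contrapT => ?; apply: h'; exists y.
Qed.

Definition translate a Y : set 'M[C]_n := fun x => exists2 y, Y y & x = a *m y.

Definition mul_set X Y : set 'M[C]_n :=
  fun x => exists2 a, X a & exists2 b, Y b & x = a *m b.

Lemma irreducible_translate a Y : irreducible_set Y ->
  irreducible_set (translate a Y).
Proof.
move=> iY p q hpq; have [tr trE] := left_translate a.
have trP r : vanishes (tr r) Y -> vanishes r (translate a Y).
  by move=> h _ [y Yy ->]; rewrite -trE h.
have [|/trP|/trP] := iY (tr p) (tr q); [|by left|by right].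
by move=> y Yy; rewrite mx_evalM !trE -mx_evalM; apply: hpq; exists y.
Qed.

Lemma irreducible_mul X Y : irreducible_set X -> irreducible_set Y ->
  irreducible_set (mul_set X Y).
Proof.
move=> iX iY p q hpq; apply: contrapT => /not_orP [].
move=> /not_vanishes [_ [a Xa [b Yb ->]] pab] /not_vanishes [_ [c Xc [d Yd ->]] qcd].
(* By irreducibility of [X] some [e] has both [p (e b)] and [q (e d)] nonzero,
   and then [Y] is reducible. *)
have [trb trbE] := right_translate b; have [trd trdE] := right_translate d.
have [e Xe pq] : exists2 e, X e & mx_eval (trb p * trd q) e <> 0.
  by apply: not_vanishes => /iX [/(_ a Xa)|/(_ c Xc)]; rewrite ?trbE ?trdE.
have [tre treE] := left_translate e; rewrite mx_evalM trbE trdE in pq.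
have [|/(_ b Yb)|/(_ d Yd)] := iY (tre p) (tre q).
- by move=> y Yy; rewrite mx_evalM !treE -mx_evalM; apply: hpq; exists e => //; exists y.
- by rewrite treE => h; apply: pq; rewrite h mul0r.
by rewrite treE => h; apply: pq; rewrite h mulr0.
Qed.

(** Noetherian induction on the vanishing ideal: if [p * q] vanishes on [X] but neither factor does,
    the loci [p = 0] and [q = 0] in [X] cover it and have strictly larger ideals. *)
Lemma irreducible_cover X : exists k (Y : 'I_k -> set 'M[C]_n),
  (forall i, irreducible_set (Y i) /\ forall x, Y i x -> X x) /\
  forall x, X x -> exists i, Y i x.
Proof.
pose P (J : {mpoly C[n * n]} -> Prop) := forall X, (forall p, J p <-> vanishes p X) ->
  exists k (Y : 'I_k -> set 'M[C]_n),
  (forall i, irreducible_set (Y i) /\ forall x, Y i x -> X x) /\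
  forall x, X x -> exists i, Y i x.
suff h J : is_ideal J -> P J by apply: (h _ (vanishing_is_ideal X)).
move: J; apply: noetherian_ind; first exact: noetherian_mpoly.
move=> J iJ IH {}X JX; have [iX|] := pselect (irreducible_set X).
  exists 1%N, (fun=> X); split=> // x Xx; by exists ord0.
move=> /existsNP [p /existsNP [q /not_implyP [pq /not_orP [np nq]]]].
have sub r : ~ vanishes r X -> exists k (Y : 'I_k -> set 'M[C]_n),
    (forall i, irreducible_set (Y i) /\ forall x, Y i x -> X x) /\
    forall x, X x -> mx_eval r x = 0 -> exists i, Y i x.
  move=> nr; pose X' : set 'M[C]_n := fun x => X x /\ mx_eval r x = 0.
  have [|||k [Y [Yi Yc]]] := IH _ (vanishing_is_ideal X') _ _ X'.
  - by move=> s /JX h y [Xy _]; apply: h.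
  - by exists r; [move=> y []|move/JX].
  - by [].
  exists k, Y; split=> [i|x Xx rx]; last exact: Yc.
  by have [? h] := Yi i; split=> // x /h [].
have [k [Y [Yi Yc]]] := sub p np; have [l [Y' [Yi' Yc']]] := sub q nq.
exists (k + l)%N, (fun i => match split i with inl a => Y a | inr b => Y' b end).
split=> [i|x Xx]; first by case: (split i).
have /eqP := pq x Xx; rewrite mx_evalM mulf_eq0 => /orP[/eqP px|/eqP qx].
  by have [i Yix] := Yc x Xx px; exists (unsplit (inl i)); rewrite unsplitK.
by have [i Yix] := Yc' x Xx qx; exists (unsplit (inr i)); rewrite unsplitK.
Qed.

Variable G : set 'M[C]_n.
Hypothesis algG : algebraic_group G.

Let G1 : G 1%:M. Proof. by case: algG. Qed.
Let GM a b : G a -> G b -> G (a *m b). Proof. by case: algG => _ _ + _; apply. Qed.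
Let GV a : G a -> G (invmx a). Proof. by case: algG => _ _ _; apply. Qed.
Let Gunit a : G a -> a \in unitmx. Proof. by case: algG => [[P ->]] _ _ _ []. Qed.

(* This union of irreducible sets is closed, since adding to an irreducible set
   a point of its closure keeps it irreducible. *)
Let H : set 'M[C]_n := fun c =>
  exists2 Y : set 'M[C]_n, (forall y, Y y -> G y) & [/\ Y 1%:M, irreducible_set Y & Y c].

Lemma component_sub c : H c -> G c.
Proof. by move=> [Y YG [_ _ Yc]]; apply: YG. Qed.

Lemma component1 : H 1%:M.
Proof.
exists (fun c => c = 1%:M); first by move=> _ ->.
split=> // p q h; have /eqP := h _ erefl; rewrite mx_evalM mulf_eq0.
by case/orP => /eqP e; [left|right] => _ ->.
Qed.

Lemma componentM a b : H a -> H b -> H (a *m b).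
Proof.
move=> [X XG [X1 iX Xa]] [Y YG [Y1 iY Yb]].
exists (mul_set X Y).
  by move=> _ [c Xc [d Yd ->]]; apply: GM; [apply: XG|apply: YG].
split; last by exists a => //; exists b.
- by exists 1%:M => //; exists 1%:M; rewrite ?mulmx1.
exact: irreducible_mul.
Qed.

(* Products of irreducible sets through the identity contain both factors. *)
Lemma component_irreducible : irreducible_set H.
Proof.
move=> p q hpq; apply: contrapT => /not_orP [].
move=> /not_vanishes [a [X XG [X1 iX Xa]] pa] /not_vanishes [b [Y YG [Y1 iY Yb]] qb].
have [z XYz|h|h] := irreducible_mul iX iY (p := p) (q := q).
- apply: hpq; exists (mul_set X Y).
    by move=> _ [c Xc [d Yd ->]]; apply: GM; [apply: XG|apply: YG].
  split=> //; last exact: irreducible_mul.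
  by exists 1%:M => //; exists 1%:M; rewrite ?mulmx1.
- by apply/pa/h; exists a => //; exists 1%:M; rewrite ?mulmx1.
by apply/qb/h; exists 1%:M => //; exists b; rewrite ?mul1mx.
Qed.

Lemma component_closed c : c \in unitmx -> (forall p, vanishes p H -> mx_eval p c = 0) -> H c.
Proof.
move=> uc hc; exists (fun x => H x \/ x = c).
  move=> x [/component_sub//|->]; case: algG => [[P eG]] _ _ _.
  rewrite eG; split=> // p Pp; apply: hc => y /component_sub.
  by rewrite eG => -[_]; apply.
split; [by left; exact: component1| |by right].
move=> p q h; have [y Hy|vp|vq] := component_irreducible (p := p) (q := q).
- by apply: h; left.
- by left=> x [/vp//|->]; apply: hc.
by right=> x [/vq//|->]; apply: hc.
Qed.

(** Left translation by [a] maps the vanishing ideal of [H] into itself, so by [subst_l_stable] the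
    inverse translation does too; evaluating at the identity puts [invmx a] in the closure of
    [H]. *)
Lemma componentV a : H a -> H (invmx a).
Proof.
move=> Ha; have ua := Gunit (component_sub Ha).
apply: component_closed; first by rewrite unitmx_inv.
move=> p hp; have : vanishes (subst_l (invmx a) p) H.
  apply: (subst_l_stable ua (vanishing_is_ideal H)) => [r hr y Hy|y Hy].
    by rewrite mx_eval_subst_l; apply: hr; apply: componentM.
  by rewrite (subst_l_comp _ (mulVmx ua)); apply: hp.
by move=> /(_ _ component1); rewrite mx_eval_subst_l mulmx1.
Qed.

Lemma component_algebraic : algebraic_group H.
Proof.
split; [|exact: component1|exact: componentM|exact: componentV].
exists (fun p => vanishes p H); apply/funext => c; apply/propext; split.
  by move=> Hc; split; [apply/Gunit/component_sub|move=> p; apply].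
by case=> uc hc; apply: component_closed.
Qed.

(** An irreducible piece of [G] translated by the inverse of one of its points passes through the
    identity, so it lies in [H]: each of the finitely many pieces lies in one coset. *)
Lemma component_finite_index : finite_index H G.
Proof.
have [k [Y [Yi Yc]]] := irreducible_cover G.
(* Empty pieces get the dummy representative 0, which no element of [G] selects. *)
have /choice [r rP] i : exists r, (exists x, Y i x) -> Y i r.
  by have [[x Yx]|h] := pselect (exists x, Y i x); [exists x|exists 0].
exists (codom r) => g Gg; have [i Yig] := Yc g Gg; exists (r i); first exact: codom_f.
have [iY YG] := Yi i; have Yir : Y i (r i) by apply: rP; exists g.
have Gr := YG _ Yir; split=> //.
exists (translate (invmx (r i)) (Y i)).
  by move=> _ [y Yy ->]; apply: GM; [apply: GV|apply: YG].
split; last by exists g.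
- by exists (r i) => //; rewrite mulVmx // Gunit.
exact: irreducible_translate.
Qed.

Lemma identity_component_exists :
  exists2 K : algGroup C n, identity_component G K & irreducible_set K.
Proof.
exists (AlgGroup component_algebraic) => /=; last exact: component_irreducible.
split=> /=; [exact: component_sub|exact: component_finite_index|].
move=> p q /asboolP h; apply/orP.
have [|vp|vq] := component_irreducible (p := p) (q := q); first exact: h.
  by left; apply/asboolP.
by right; apply/asboolP.
Qed.

End IdentityComponent.

(** * Matrices of the differential Galois group *)

Section PicardVessiotMatrices.
Variables (K M : diffFieldType) (iota : {rmorphism K -> M}) (n : nat) (u : 'I_n -> M).
Hypothesis pvM : picard_vessiot iota u.

Local Notation C := (constants K).

Definition const_emb : {rmorphism C -> M} := iota \o (val : C -> K).
Local Notation j := const_emb.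

Lemma der_iota x : der (iota x) = iota (der x).
Proof. by case: pvM => ->. Qed.

Lemma der_sum (I : Type) (r : seq I) (P : pred I) (E : I -> M) :
  der (\sum_(i <- r | P i) E i) = \sum_(i <- r | P i) der (E i).
Proof. by apply: (big_morph _ (@derD M)); apply: der0. Qed.

Lemma der_const_emb c : der (j c) = 0.
Proof. by rewrite /= der_iota; have /eqP -> := const_valP c; rewrite rmorph0. Qed.

Lemma const_embP x : der x = 0 -> exists c, j c = x.
Proof. by move=> dx; case: pvM => _ _ _; apply; rewrite inE dx. Qed.

Definition wronsky : 'M[M]_n := \matrix_(i < n, k < n) iter k der (u i).
Local Notation Z := wronsky.

Lemma wronsky_unit : \det Z != 0.
Proof. by case: pvM => _ [a []]. Qed.

(** [A] is the companion matrix of the equation. It acts on the right because the rows of [Z] are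
    indexed by solutions, so left multiples of [Z] by constant matrices satisfy the same system. *)
Lemma der_wronsky : exists A : 'M[K]_n, map_mx (@der M) Z = Z *m map_mx iota A.
Proof.
have [_ [a [ua _]] _ _] := pvM.
exists (\matrix_(l, k) if (k.+1 < n)%N then (l == k.+1 :> nat)%:R else - a l).
apply/matrixP => i k; rewrite !mxE; case: (ltnP k.+1 n) => kn.
  rewrite (bigD1 (Ordinal kn)) //= big1 ?addr0 => [|l lk]; rewrite !mxE kn.
    by rewrite eqxx rmorph1 mulr1.
  by rewrite -val_eqE /= in lk; rewrite (negbTE lk) rmorph0 mulr0.
have -> : der (iter k der (u i)) = iter n der (u i).
  by rewrite -iterS (_ : k.+1 = n) //; apply/eqP; rewrite eqn_leq kn ltn_ord.
have := ua i; rewrite /lin_diff_eq => /eqP; rewrite addr_eq0 => /eqP->; rewrite -sumrN; apply: eq_bigr => l _.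
by rewrite !mxE ltnNge kn /= rmorphN mulrN mulrC.
Qed.

Definition is_derivation (B : comNzRingType) (d : B -> B) :=
  (forall x y, d (x + y) = d x + d y) /\ forall x y, d (x * y) = d x * y + x * d y.

(* A derivation of K[x] which is compatible with evaluation at every solution
   [W] of the matrix differential equation [W' = W A]. *)
Lemma formal_derivation (A : 'M[K]_n) (p : {mpoly K[n * n]}) :
  exists p', forall (B : comNzRingType) (d : B -> B) (g : {rmorphism K -> B}) W,
    is_derivation d -> (forall x, d (g x) = g (der x)) ->
    map_mx d W = W *m map_mx g A -> d (evm g W p) = evm g W p'.
Proof.
elim/mpoly_ring_ind: p => [c|k|p q [p' hp] [q' hq]|p q [p' hp] [q' hq]].
- by exists (der c)%:MP => B d g W _ dg _; rewrite !evmC dg.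
- exists (mxvec (gen_mx n K *m map_mx (@mpolyC (n * n) K) A) 0 k) => B d g W _ _ dW.
  rewrite evmX; transitivity
    (map_mx (evm g W) (mxvec (gen_mx n K *m map_mx (@mpolyC (n * n) K) A)) 0 k); last by rewrite mxE.
  by rewrite map_mxvec map_mxM evm_gen map_evmC -dW -map_mxvec mxE.
- exists (p' + q') => B d g W dd dg dW; have [dD _] := dd.
  by rewrite !rmorphD dD (hp _ _ _ _ dd dg dW) (hq _ _ _ _ dd dg dW).
exists (p' * q + p * q') => B d g W dd dg dW; have [_ dM] := dd.
by rewrite rmorphD !rmorphM dM (hp _ _ _ _ dd dg dW) (hq _ _ _ _ dd dg dW).
Qed.

Lemma der_is_derivation (L : diffFieldType) : is_derivation (@der L).
Proof. by split; [exact: derD|exact: derM]. Qed.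

Local Notation evZ := (evm iota Z).

Lemma evZ_der p : exists p', der (evZ p) = evZ p'.
Proof.
have [A dZ] := der_wronsky; have [p' hp] := formal_derivation A p.
exists p'; exact: (hp _ _ _ _ (@der_is_derivation M) der_iota dZ).
Qed.

(** Fractions of elements of K[Z] form a differential subfield, because K[Z] is stable under
    derivation by [evZ_der], and they contain the generators of [M]. *)
Lemma fractions x : exists p q, evZ q != 0 /\ x * evZ q = evZ p.
Proof.
have [_ _ gen _] := pvM.
pose S : set M := fun x => exists p q, evZ q != 0 /\ x * evZ q = evZ p.
suff sub : smallest (@diff_subfield M) (range iota `|` range u)%classic x -> S x.
  by apply: sub; rewrite -/(diff_generated iota u) gen.
apply: smallest_sub; last first.
  move=> _ [[y _ <-]|[i _ <-]].
    by exists y%:MP, 1; rewrite rmorph1 oner_neq0 mulr1 evmC.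
  have n0 : (0 < n)%N by apply: leq_ltn_trans (ltn_ord i).
  exists 'X_(mxvec_index i (Ordinal n0)), 1; rewrite rmorph1 oner_neq0 mulr1 evmX.
  by rewrite mxvecE mxE.
split=> [|y z [p [q [q0 e]]] [p' [q' [q0' e']]]|y z [p [q [q0 e]]] [p' [q' [q0' e']]]|y [p [q [q0 e]]]].
- by exists 1, 1; rewrite rmorph1 oner_neq0 mulr1.
- exists (p * q' - p' * q), (q * q'); rewrite rmorphB !rmorphM mulf_neq0 //; split=> //.
  by rewrite -e -e'; ring.
- have [->|z0] := eqVneq z 0.
    by exists 0, 1; rewrite rmorph0 rmorph1 oner_neq0 invr0 mulr0 mul0r.
  exists (p * q'), (q * p'); rewrite !rmorphM -e -e' !mulf_neq0 //; split=> //.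
  by field.
have [p' ep] := evZ_der p; have [q' eq] := evZ_der q.
exists (p' * q - p * q'), (q * q); rewrite rmorphB !rmorphM mulf_neq0 //; split=> //.
by rewrite -ep -eq -e derM; ring.
Qed.

(* [c Z] is the image of [Z] under the automorphism attached to [c]. *)
Definition ev_galois (c : 'M[C]_n) := evm iota (map_mx j c *m Z).

Definition is_galois_mx (c : 'M[C]_n) :=
  c \in unitmx /\ forall p, evZ p = 0 -> ev_galois c p = 0.

Lemma evc_subst c p : evZ (subst_l (map_mx val c) p) = ev_galois c p.
Proof. by rewrite evm_subst_l -map_mx_comp. Qed.

Lemma evZ_prime : is_prime (fun p => evZ p = 0).
Proof.
split; [split|by rewrite rmorph1; apply/eqP; rewrite oner_eq0|].
- exact: rmorph0.
- by move=> p q; rewrite rmorphD => -> ->; rewrite addr0.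
- by move=> p q; rewrite rmorphM => ->; rewrite mulr0.
by move=> p q /eqP; rewrite rmorphM mulf_eq0 => /orP[] /eqP; [left|right].
Qed.

(** The inclusion of relation ideals required of [c] is an equality by noetherian stability, so
    denominators stay nonzero in [galois_aut]. *)
Lemma galois_mxP c p : is_galois_mx c -> evZ p = 0 <-> ev_galois c p = 0.
Proof.
move=> [uc hc]; split=> [/hc//|]; rewrite -evc_subst.
apply: (subst_l_stable (I := fun p => evZ p = 0)); first by rewrite map_unitmx.
  by case: evZ_prime.
by move=> q /hc; rewrite evc_subst.
Qed.

Lemma galois_mx1 : is_galois_mx 1%:M.
Proof.
by split=> [|p]; [exact: unitmx1|rewrite /ev_galois map_mx1 mul1mx].
Qed.

Lemma galois_mxM c d : is_galois_mx c -> is_galois_mx d -> is_galois_mx (c *m d).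
Proof.
move=> [uc hc] [ud hd]; split=> [|p /hc]; first by rewrite unitmx_mul uc.
rewrite -evc_subst => /hd; rewrite /ev_galois evm_subst_l.
by rewrite -map_mx_comp map_mxM mulmxA.
Qed.

Lemma galois_mxV c : is_galois_mx c -> is_galois_mx (invmx c).
Proof.
move=> gc; have [uc hc] := gc; split=> [|p hp]; first by rewrite unitmx_inv.
rewrite -evc_subst; apply/(galois_mxP _ gc).
rewrite /ev_galois evm_subst_l -map_mx_comp mulmxA -map_mxM mulVmx //.
by rewrite map_mx1 mul1mx.
Qed.

Lemma iter_der_const (c : 'M[C]_n) i l :
  iter l der (\sum_m j (c i m) * u m) = \sum_m j (c i m) * iter l der (u m).
Proof.
elim: l => //= l ->; rewrite der_sum; apply: eq_bigr => m _.
by rewrite derM der_const_emb mul0r add0r.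
Qed.

Lemma galois_matrices_sub c : galois_matrices iota u c -> is_galois_mx c.
Proof.
move=> [sigma [_ sder siota] su].
have sZ : map_mx sigma Z = map_mx j c *m Z.
  apply/matrixP => i k; rewrite !mxE.
  have -> : sigma (iter k der (u i)) = iter k der (sigma (u i)).
    by elim: (k : nat) => //= l <-; rewrite sder.
  by rewrite su iter_der_const; apply: eq_bigr => m _; rewrite !mxE.
have sE p : sigma (evZ p) = ev_galois c p by rewrite /ev_galois -sZ; apply: evm_comp.
split=> [|p evp]; last by rewrite -sE evp rmorph0.
have : \det (map_mx j c *m Z) != 0 by rewrite -sZ det_map_mx fmorph_eq0 wronsky_unit.
by rewrite det_mulmx mulf_eq0 negb_or det_map_mx fmorph_eq0 unitmxE unitfE => /andP[].
Qed.

Lemma der_const_mx (c : 'M[C]_n) : map_mx (@der M) (map_mx j c *m Z) = map_mx j c *m map_mx (@der M) Z.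
Proof.
apply/matrixP => i k; rewrite !mxE der_sum; apply: eq_bigr => l _.
by rewrite !mxE derM der_const_emb mul0r add0r.
Qed.

(** A fraction of values at [Z] goes to the fraction of values at [c Z]. This commutes with the
    derivation because [c Z] solves the same system as [Z], and is onto by substitution with
    [invmx c]. *)
Lemma galois_aut c : is_galois_mx c -> exists2 sigma : {rmorphism M -> M},
  diff_galois iota sigma & forall p, sigma (evZ p) = ev_galois c p.
Proof.
move=> gc; have gP p := galois_mxP p gc.
have ev_neq0 q : evZ q != 0 -> ev_galois c q != 0 by apply: contra_neq => /gP.
have /choice [pq pqP] : forall x, exists pq, evZ pq.2 != 0 /\ x * evZ pq.2 = evZ pq.1.
  by move=> x; have [p [q h]] := fractions x; exists (p, q).
pose f x := ev_galois c (pq x).1 / ev_galois c (pq x).2.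
have fE x p q : evZ q != 0 -> x * evZ q = evZ p -> f x * ev_galois c q = ev_galois c p.
  move=> q0 e; have [q0' e'] := pqP x; have n0 := ev_neq0 _ q0'.
  have /gP : evZ ((pq x).1 * q - p * (pq x).2) = 0.
    by rewrite rmorphB !rmorphM -e -e'; ring.
  rewrite rmorphB !rmorphM => /eqP; rewrite subr_eq0 => /eqP h.
  by rewrite /f mulrAC h mulfK.
have fevZ p : f (evZ p) = ev_galois c p.
  by rewrite -[LHS]mulr1 -(rmorph1 (ev_galois c)); apply: fE; rewrite rmorph1 ?oner_neq0 ?mulr1.
have fB : zmod_morphism f.
  move=> x y; have [p [q [q0 e]]] := fractions x; have [p' [q' [q0' e']]] := fractions y.
  have qq0 : evZ (q * q') != 0 by rewrite rmorphM mulf_neq0.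
  have e2 : (x - y) * evZ (q * q') = evZ (p * q' - p' * q).
    by rewrite rmorphB !rmorphM -e -e'; ring.
  apply: (mulIf (ev_neq0 _ qq0)); rewrite (fE _ _ _ qq0 e2) rmorphB !rmorphM.
  by rewrite -(fE _ _ _ q0 e) -(fE _ _ _ q0' e'); ring.
have fM : monoid_morphism f.
  split=> [|x y]; first by rewrite -[in LHS](rmorph1 evZ) fevZ rmorph1.
  have [p [q [q0 e]]] := fractions x; have [p' [q' [q0' e']]] := fractions y.
  have qq0 : evZ (q * q') != 0 by rewrite rmorphM mulf_neq0.
  have e2 : (x * y) * evZ (q * q') = evZ (p * p') by rewrite !rmorphM -e -e'; ring.
  apply: (mulIf (ev_neq0 _ qq0)); rewrite (fE _ _ _ qq0 e2) !rmorphM.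
  by rewrite -(fE _ _ _ q0 e) -(fE _ _ _ q0' e'); ring.
pose bA := GRing.isZmodMorphism.Build M M f fB.
pose bM := GRing.isMonoidMorphism.Build M M f fM.
pose sigma : {rmorphism M -> M} := HB.pack f bA bM.
have sE p : sigma (evZ p) = ev_galois c p by exact: fevZ.
exists sigma => //; split.
- have surj y : exists x, sigma x = y.
    have [p [q [q0 e]]] := fractions y.
    pose sb := subst_l (map_mx val (invmx c)).
    have sbE r : sigma (evZ (sb r)) = evZ r.
      rewrite sE /ev_galois evm_subst_l -map_mx_comp mulmxA -map_mxM mulVmx ?map_mx1 ?mul1mx //.
      by case: gc.
    exists (evZ (sb p) / evZ (sb q)); rewrite fmorph_div !sbE.
    by rewrite -e mulfK.
  have [g gK] := choice surj; exists g => // x.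
  by apply: (fmorph_inj sigma); rewrite gK.
- have [A dZ] := der_wronsky.
  have sd p : sigma (der (evZ p)) = der (sigma (evZ p)).
    have [p' hp] := formal_derivation A p.
    rewrite (hp _ _ _ _ (@der_is_derivation M) der_iota dZ) !sE /ev_galois.
    rewrite (hp _ _ _ _ (@der_is_derivation M) der_iota) //.
    by rewrite der_const_mx dZ mulmxA.
  move=> x; have [p [q [q0 e]]] := fractions x.
  have sq0 : sigma (evZ q) != 0 by rewrite fmorph_eq0.
  have : sigma (der (x * evZ q)) = der (sigma (x * evZ q)) by rewrite e sd.
  by rewrite derM rmorphD !rmorphM derM sd => /addIr/(mulIf sq0).
by move=> x; have := sE x%:MP; rewrite [evZ _]evmC /ev_galois evmC.
Qed.

Lemma galois_aut_u c (sigma : {rmorphism M -> M}) :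
  (forall p, sigma (evZ p) = ev_galois c p) -> map_mx sigma Z = map_mx j c *m Z.
Proof.
move=> sE; apply: (can_inj mxvecK); apply/rowP => k.
by rewrite -map_mxvec mxE -(evmX iota) sE /ev_galois evmX.
Qed.

Lemma galois_matricesE c : galois_matrices iota u c <-> is_galois_mx c.
Proof.
split; first exact: galois_matrices_sub.
move=> /galois_aut [sigma sG sE]; exists sigma => // i.
have n0 : (0 < n)%N by apply: leq_ltn_trans (ltn_ord i).
have := congr1 (fun W : 'M_n => W i (Ordinal n0)) (galois_aut_u sE).
by rewrite !mxE /= => ->; apply: eq_bigr => k _; rewrite !mxE.
Qed.

(** This is p(Y Z) in M[Y]: its value at a constant matrix [c] is [ev_galois c p], which turns the
    conditions on [c] into polynomial equations over [M]. *)
Definition twist_poly : {rmorphism {mpoly K[n * n]} -> {mpoly M[n * n]}} :=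
  evm (@mpolyC (n * n) M \o iota) (gen_mx n M *m map_mx (@mpolyC (n * n) M) Z).

Definition ev_const (c : 'M[C]_n) : {rmorphism {mpoly M[n * n]} -> M} :=
  evm idfun (map_mx j c).

Lemma ev_constE c p : ev_const c p = p.@[fun k => j (mxvec c 0 k)].
Proof.
rewrite /ev_const /evm /= /meval; congr mmap; apply/funext => k.
by rewrite -map_mxvec mxE.
Qed.

Lemma ev_const_twist c p : ev_const c (twist_poly p) = ev_galois c p.
Proof.
rewrite /twist_poly (evm_comp (h := iota)) => [|x]; last by rewrite /ev_const /= evmC.
by rewrite map_mxM evm_gen map_evmC map_mx_id.
Qed.

Lemma ev_const_eq0 (T : {mpoly M[n * n]}) : exists r (q : 'I_r -> {mpoly C[n * n]}),
  (forall c, ev_const c T = 0 <-> forall k, mx_eval (q k) c = 0) /\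
  exists2 e : 'I_r -> M, lin_indep j e & T = \sum_k e k *: map_mpoly j (q k).
Proof.
have [r [e [q [ie _ eT]]]] := mpoly_basis_expansion j T.
exists r, q; split; last by exists e.
by move=> c; rewrite ev_constE eT; apply: lin_indep_eq0.
Qed.

(** The equations are all polynomials over [C] vanishing on the group. They suffice because each
    condition on [c], an equation over [M], splits by [ev_const_eq0] into polynomials over [C] that
    vanish on the group. *)
Lemma galois_algebraic : algebraic_group (galois_matrices iota u).
Proof.
have -> : galois_matrices iota u = is_galois_mx.
  by apply/funext => c; apply/propext; apply: galois_matricesE.
split; [|exact: galois_mx1|exact: galois_mxM|exact: galois_mxV].
exists (fun p : {mpoly C[n * n]} => vanishes p is_galois_mx); apply/funext => c; apply/propext; split.
  by move=> gc; split=> [|p]; [case: gc|apply].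
move=> [uc hc]; split=> // p evp; rewrite -ev_const_twist.
have [r [q [qP _]]] := ev_const_eq0 (twist_poly p).
apply/qP => k; apply: hc => d [_ gd]; move: k; apply/qP.
by rewrite ev_const_twist; apply: gd.
Qed.

End PicardVessiotMatrices.

(** * Fixed field of the Galois group *)

Lemma tensor_relation (F L : fieldType) (g : {rmorphism F -> L}) n (I : finType)
    (w : I -> L) (R : I -> {mpoly F[n]}) r (e : 'I_r -> L) (B : I -> 'I_r -> F) :
  lin_indep g e -> (forall t, w t = \sum_k g (B t k) * e k) ->
  \sum_t w t *: map_mpoly g (R t) = 0 -> forall k, \sum_t B t k *: R t = 0.
Proof.
move=> ie wB wR k; apply/mpolyP => m; rewrite mcoeff0 raddf_sum /=.
under eq_bigr do rewrite mcoeffZ.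
apply: (ie (fun k => \sum_t B t k * (R t)@_m)).
have := congr1 (mcoeff m) wR; rewrite mcoeff0 raddf_sum /= => h; rewrite -[RHS]h.
under eq_bigr do rewrite rmorph_sum mulr_suml.
rewrite exchange_big /=; apply: eq_bigr => t _.
rewrite mcoeffZ mcoeff_map_mpoly wB mulr_suml; apply: eq_bigr => l _.
by rewrite rmorphM mulrAC.
Qed.

Lemma map_mpoly_inj (F L : fieldType) (g : {rmorphism F -> L}) n :
  injective (map_mpoly (n := n) g).
Proof.
move=> p q e; apply/mpolyP => m; apply: (fmorph_inj g).
by rewrite -!mcoeff_map_mpoly e.
Qed.

(* A power of 'X - a in the span of the polynomials over F vanishing at a is
   divisible by the minimal polynomial of a, which is separable. *)
Lemma root_of_power (F L : fieldType) (g : {rmorphism F -> L}) a N r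
    (e : 'I_r -> L) (p : 'I_r -> {poly F}) :
  [pchar F] =i pred0 -> (forall k, root (map_poly g (p k)) a) ->
  \sum_k e k *: map_poly g (p k) = ('X - a%:P) ^+ N -> exists x, g x = a.
Proof.
move=> /pcharf0P char0 pa pN.
have [f [f0 fa] fmin] : exists2 f : {poly F}, f != 0 /\ root (map_poly g f) a &
    forall f', f' != 0 /\ root (map_poly g f') a -> (size f <= size f')%N.
  apply: exists_minimal; apply: contrapT => h.
  have : ('X - a%:P) ^+ N != 0 by rewrite expf_neq0 // polyXsubC_eq0.
  rewrite -pN big1 ?eqxx // => k _.
  have [->|p0] := eqVneq (p k) 0; first by rewrite map_poly0 scaler0.
  by case: h; exists (p k).
have fdvd q : root (map_poly g q) a -> f %| q.
  move=> qa; apply/negPn/negP => nd.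
  have := fmin (q %% f); rewrite leqNgt ltn_modp f0 => /(_ _)/negP[]//.
  split=> //; move: qa; rewrite /root {1}(divp_eq q f) rmorphD rmorphM hornerD hornerM.
  by rewrite (eqP fa) mulr0 add0r.
have : map_poly g f %| ('X - a%:P) ^+ N.
  rewrite -pN; apply: (big_ind (fun q => map_poly g f %| q)) => [|q q'|k _].
  - exact: dvdp0.
  - exact: dvdp_add.
  by rewrite -mul_polyC dvdp_mull // dvdp_map fdvd.
case/dvdp_exp_XsubCP => [[|k] _ /eqpf_eq [c c0 ef]].
  by move: fa; rewrite ef expr0 /root hornerZ hornerC mulr1 (negbTE c0).
have sf : size f = k.+2.
  by rewrite -(size_map_poly g) ef size_scale // size_exp_XsubC.
case: k => [|k] in ef sf *.
  have f10 : f`_1 != 0 by rewrite -[X in f`_X]/(2.-1) -sf -/(lead_coef f) lead_coef_eq0.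
  exists (- f`_0 / f`_1); move: fa; rewrite /root horner_coef size_map_poly sf.
  rewrite big_ord_recl big_ord1 /= !coef_map expr0 mulr1 expr1 addrC addr_eq0 => /eqP fa.
  apply: (mulfI (_ : g f`_1 != 0)); first by rewrite fmorph_eq0.
  by rewrite fa -rmorphM mulrCA divff // mulr1 rmorphN.
(* If [a] is a multiple root, the derivative of [f], nonzero in characteristic 0, still vanishes at
   [a] and has smaller size. *)
have /fmin : deriv f != 0 /\ root (map_poly g (deriv f)) a.
  split; last first.
    rewrite -deriv_map ef derivZ deriv_exp derivXsubC mul1r /root hornerZ hornerMn.
    by rewrite horner_exp hornerXsubC subrr expr0n /= mul0rn mulr0.
  apply/eqP => /(congr1 (fun q : {poly F} => q`_k.+1)); rewrite coef0 coef_deriv => /eqP.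
  rewrite -mulr_natr mulf_eq0 char0 /= orbF -[k.+2]/(k.+3.-1) -sf -/(lead_coef f).
  by rewrite lead_coef_eq0 (negbTE f0).
by rewrite leqNgt lt_size_deriv.
Qed.

Section GaloisCorrespondence.
Variables (K M : diffFieldType) (iota : {rmorphism K -> M}) (n : nat) (u : 'I_n -> M).
Hypothesis pvM : picard_vessiot iota u.
Hypothesis char0 : [pchar K] =i pred0.

Local Notation C := (constants K).
Local Notation j := (const_emb iota).
Local Notation Z := (wronsky u).
Local Notation evZ := (evm iota (wronsky u)).
Local Notation evc := (ev_galois iota u).
Local Notation twist := (twist_poly iota u).
Local Notation galois_mx := (is_galois_mx iota u).

(** The extension to M[Y] of the ideal of relations of [Z] over [K], as explicit finite sums so that
    their coefficients can later be expanded over [K]. *)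
Let span_of_relations (T : {mpoly M[n * n]}) :=
  exists k (m : 'I_k -> M) (p : 'I_k -> {mpoly K[n * n]}),
    (forall l, evZ (p l) = 0) /\ T = \sum_l m l *: map_mpoly iota (p l).

Let span0 : span_of_relations 0.
Proof. by exists 0%N, (fun=> 0), (fun=> 0); split=> [|]; rewrite ?big_ord0 // => -[]. Qed.

Let spanD S T : span_of_relations S -> span_of_relations T -> span_of_relations (S + T).
Proof.
move=> [k [m [p [hp ->]]]] [l [m' [p' [hp' ->]]]].
exists (k + l)%N, (fun i => match split i with inl a => m a | inr b => m' b end),
  (fun i => match split i with inl a => p a | inr b => p' b end).
split=> [i|]; first by case: (split i).
rewrite big_split_ord /=; congr (_ + _); apply: eq_bigr => i _.
  by rewrite -[lshift l i]/(unsplit (inl i)) unsplitK.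
by rewrite -[rshift k i]/(unsplit (inr i)) unsplitK.
Qed.

Let spanM S T : span_of_relations T -> span_of_relations (S * T).
Proof.
elim/mpoly_ring_ind: S T => [c|i|S S' hS hS'|S S' hS hS'] T sT.
- case: sT => [k [m [p [hp ->]]]]; exists k, (fun l => c * m l), p; split=> //.
  by rewrite mul_mpolyC scaler_sumr; apply: eq_bigr => l _; rewrite scalerA.
- case: sT => [k [m [p [hp ->]]]]; exists k, m, (fun l => 'X_i * p l); split=> [l|].
    by rewrite rmorphM hp mulr0.
  by rewrite mulr_sumr; apply: eq_bigr => l _; rewrite rmorphM /= map_mpolyX scalerAr.
- by rewrite mulrDl; apply: spanD; [apply: hS|apply: hS'].
by rewrite -mulrA; apply/hS/hS'.
Qed.

Let span_is_ideal : is_ideal span_of_relations.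
Proof. by split; [exact: span0|exact: spanD|exact: spanM]. Qed.

(* The ideal of M[Y] expressing that [Y Z] satisfies all the relations of [Z]. *)
Let J := ideal_gen (fun T => exists2 p, evZ p = 0 & T = twist p).

Let J_ideal : is_ideal J. Proof. exact: ideal_gen_ideal. Qed.

Let wronsky_unitmx : Z \in unitmx.
Proof. by rewrite unitmxE unitfE; apply: wronsky_unit pvM. Qed.

(** Substituting Y Z^-1 for Y carries [J] to the extension of the relation ideal, which identifies
    M[Y]/J with the tensor product of M and K[Z] over K. *)
Lemma untwist : exists psi : {rmorphism {mpoly M[n * n]} -> {mpoly M[n * n]}},
  [/\ forall x, psi x%:MP = x%:MP, forall p, psi (twist p) = map_mpoly iota p &
    forall W p, evm idfun W (psi p) = evm idfun (W *m invmx Z) p].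
Proof.
exists (subst_r (invmx Z)); split=> [x|p|W p]; first exact: evmC; last first.
  by rewrite evm_subst_r map_mx_id.
rewrite /twist_poly (evm_comp (h := @mpolyC (n * n) M \o iota)) => [|x]; last exact: evmC.
rewrite map_mxM map_evmC evm_gen -mulmxA -map_mxM mulVmx // map_mx1 mulmx1.
elim/mpoly_ring_ind: p => [c|k|p q ep eq|p q ep eq].
- by rewrite evmC map_mpolyC.
- by rewrite evmX vec_mxK mxE map_mpolyX.
- by rewrite !rmorphD ep eq.
by rewrite !rmorphM ep eq.
Qed.

Lemma J_span (psi : {rmorphism {mpoly M[n * n]} -> {mpoly M[n * n]}}) T :
  (forall p, psi (twist p) = map_mpoly iota p) -> J T -> span_of_relations (psi T).
Proof.
move=> psi_twist JT; apply: (JT (fun T => span_of_relations (psi T))).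
  exact: (ideal_preim psi span_is_ideal).
move=> _ [p hp ->]; rewrite psi_twist; exists 1%N, (fun=> 1), (fun=> p); split=> //.
by rewrite big_ord1 scale1r.
Qed.

Lemma map_der_derivation : exists d : {mpoly M[n * n]} -> {mpoly M[n * n]},
  is_derivation d /\ forall p m, (d p)@_m = der p@_m.
Proof.
pose bD := GRing.isZmodMorphism.Build M M (@der M) (fun x y => etrans (derD _ _) (congr1 (+%R _) (derN _))).
pose dM : {additive M -> M} := HB.pack (@der M) bD.
exists (map_mpoly dM); split=> [|p m]; last by rewrite mcoeff_map_mpoly.
split=> [x y|x y]; first exact: raddfD.
pose D := map_mpoly (n := n * n) dM.
have D0 : D 0 = 0 by exact: raddf0.
have DD p q : D (p + q) = D p + D q by exact: raddfD.
have DZ c p : D (c *: p) = der c *: p + c *: D p.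
  by apply/mpolyP => m; rewrite mcoeffD !mcoeffZ !mcoeff_map_mpoly mcoeffZ /= derM.
have DX m : D 'X_[m] = 0.
  apply/mpolyP => k; rewrite mcoeff_map_mpoly mcoeffX mcoeff0 /=.
  by case: eqP => _; rewrite ?der1 ?der0.
have DXM m p : D ('X_[m] * p) = 'X_[m] * D p.
  elim/mpolyind: p => [|c k p _ _ IH]; first by rewrite mulr0 D0 mulr0.
  rewrite mulrDr !DD mulrDr IH; congr (_ + _).
  by rewrite -scalerAr -mpolyXD !DZ !DX !scaler0 !addr0 mpolyXD scalerAr.
rewrite -/D; elim/mpolyind: x => [|c k p _ _ IH]; first by rewrite D0 !mul0r addr0.
rewrite mulrDl !DD IH -scalerAl !DZ DXM DX scaler0 addr0.
by rewrite !mulrDl -!scalerAl; ring.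
Qed.

(** With Y treated as constant, Y Z satisfies the system of [Z]. So [d (twist p)] is [twist p'] for
    the formal derivative [p'], again a relation since [evZ p'] is the derivative of 0. *)
Lemma J_der (d : {mpoly M[n * n]} -> {mpoly M[n * n]}) :
  is_derivation d -> (forall p m, (d p)@_m = der p@_m) -> forall T, J T -> J (d T).
Proof.
move=> dd dE T JT; have [dD dM] := dd.
have [J0 JD JM] := J_ideal.
suff [] : J T /\ J (d T) by [].
apply: (JT (fun T => J T /\ J (d T))).
  split=> [|x y [Jx Jdx] [Jy Jdy]|a x [Jx Jdx]].
  - split=> //; have -> : d 0 = 0; last exact: J0.
    by apply/mpolyP => m; rewrite dE mcoeff0 der0.
  - by split; [exact: JD|rewrite dD; exact: JD].
  by split; [exact: JM|rewrite dM; apply: JD; apply: (JM)].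
have [A dZ] := der_wronsky pvM.
have dC c : d c%:MP = (der c)%:MP.
  apply/mpolyP => m; rewrite dE !mcoeffC; case: eqP => _; first by rewrite !mulr1.
  by rewrite !mulr0 der0.
have d0 : d 0 = 0 by rewrite -mpolyC0 dC der0.
have dX k : d 'X_k = 0.
  apply/mpolyP => m; rewrite dE mcoeffX mcoeff0.
  by case: eqP => _; rewrite ?der1 ?der0.
have dsum (I : Type) (r : seq I) (E : I -> {mpoly M[n * n]}) :
  d (\sum_(i <- r) E i) = \sum_(i <- r) d (E i) by apply: big_morph.
move=> _ [p hp ->]; split; first by apply: ideal_gen_mem; exists p.
have [p' hp'] := formal_derivation A p.
rewrite (hp' _ d) //.
- apply: ideal_gen_mem; exists p' => //.
  have := hp' _ _ _ _ (@der_is_derivation M) (der_iota pvM) dZ.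
  by rewrite hp der0 => <-.
- by move=> x; rewrite /= dC (der_iota pvM).
have -> : map_mx (@mpolyC (n * n) M \o iota) A = map_mx (@mpolyC (n * n) M) (map_mx iota A).
  by rewrite -map_mx_comp.
rewrite -mulmxA -map_mxM -dZ; apply/matrixP => i k; rewrite !mxE dsum.
apply: eq_bigr => l _; rewrite !mxE dM dX mul0r add0r dC.
by [].
Qed.

Hypothesis closedC : GRing.closed_field_axiom C.

Lemma det_poly : exists D, forall (A : comNzRingType) (g : {rmorphism K -> A}) (W : 'M[A]_n),
  evm g W D = \det W.
Proof.
by exists (\det (gen_mx n K)) => A g W; rewrite -det_map_mx evm_gen.
Qed.

(** After [untwist], the binomial expansion of [(d * (p - a q)) ^ N] equals a combination of
    relations. Expanding its coefficients, the powers of [a] included, along elements of [M]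
    independent over [K] gives polynomials [pk] over [K] that vanish at [a] and combine to
    [('X - a) ^ N]. *)
Lemma nilpotent_fixed a p q d N :
  evZ q != 0 -> evZ d != 0 -> a * evZ q = evZ p ->
  J ((twist d * (twist p - a *: twist q)) ^+ N) -> exists x, iota x = a.
Proof.
move=> q0 d0 apq; have [psi [psiC psi_twist _]] := untwist.
move=> /(J_span psi_twist); rewrite rmorphXn rmorphM rmorphB -mul_mpolyC rmorphM psiC.
rewrite !psi_twist mul_mpolyC => -[l [m [s [hs]]]].
rewrite exprMn exprBn mulr_sumr => e0.
pose S (i : 'I_N.+1) := d ^+ N * ((-1) ^+ i * p ^+ (N - i) * q ^+ i) *+ 'C(N, i).
pose w (t : 'I_(N.+1 + l)) := match split t with inl i => a ^+ i | inr k => m k end.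
pose R (t : 'I_(N.+1 + l)) := match split t with inl i => S i | inr k => - s k end.
have wR : \sum_t w t *: map_mpoly iota (R t) = 0.
  rewrite big_split_ord /= -[RHS](subrr (\sum_k m k *: map_mpoly iota (s k))) -[X in _ = X - _]e0.
  congr (_ + _); [|rewrite -sumrN]; apply: eq_bigr => i _; rewrite /w /R.
    rewrite -[lshift l i]/(unsplit (inl i)) unsplitK /S rmorphMn !rmorphM !rmorphXn rmorphN1.
    rewrite -!mul_mpolyC rmorphXn exprMn; ring.
  by rewrite -[rshift N.+1 i]/(unsplit (inr i)) unsplitK rmorphN scalerN.
have [r [e [B [ie wB]]]] := finite_basis iota w.
have rel := tensor_relation ie wB wR.
pose pk (k : 'I_r) : {poly K} :=
  \sum_(i < N.+1) (B (lshift l i) k * (-1) ^+ i *+ 'C(N, i)) *: 'X^(N - i).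
apply: (@root_of_power _ _ iota a N r e pk) => // [k|].
  have := congr1 evZ (rel k); rewrite rmorph0 rmorph_sum big_split_ord /= [X in _ + X]big1 ?addr0; last first.
    move=> i _; rewrite evmZ /R -[rshift N.+1 i]/(unsplit (inr i)) unsplitK rmorphN hs.
    by rewrite oppr0 mulr0.
  move=> h; have dq0 : evZ d ^+ N * evZ q ^+ N != 0 by rewrite mulf_neq0 ?expf_neq0.
  apply/eqP/(mulIf dq0); rewrite mul0r -[RHS]h rmorph_sum horner_sum mulr_suml.
  apply: eq_bigr => i _; rewrite evmZ /R -[lshift l i]/(unsplit (inl i)) unsplitK /S.
  rewrite -[X in X.[a]]/(map_poly iota _) map_polyZ map_polyXn hornerZ hornerXn.
  rewrite !rmorphMn !rmorphM !rmorphXn !rmorphN1 -apq exprMn.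
  have -> : evZ q ^+ N = evZ q ^+ (N - i) * evZ q ^+ i by rewrite -exprD subnK // -ltnS.
  rewrite !mulrnAl !mulrnAr; congr (_ *+ _).
  by move: (iota _) (evZ d ^+ N) (evZ q ^+ _) (evZ q ^+ _) (_ ^+ i) (a ^+ _) => *; ring.
have -> : ('X - a%:P) ^+ N = \sum_(i < N.+1) a ^+ i *: (((-1) ^+ i *+ 'C(N, i)) *: 'X^(N - i)).
  rewrite exprBn; apply: eq_bigr => i _.
  rewrite -scalerMnl -scalerMnr; congr (_ *+ _).
  by rewrite -!mul_polyC !rmorphXn rmorphN1; ring.
under eq_bigr do rewrite rmorph_sum scaler_sumr.
rewrite exchange_big /=; apply: eq_bigr => i _.
have -> : a ^+ i = w (lshift l i) by rewrite /w -[lshift l i]/(unsplit (inl i)) unsplitK.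
rewrite wB scaler_suml; apply: eq_bigr => k _.
rewrite map_polyZ map_polyXn rmorphMn rmorphM rmorphXn rmorphN1 !scalerA.
by congr (_ *: _); rewrite !mulrnAr; congr (_ *+ _); ring.
Qed.

(* The Galois group has fixed field K: for [a] outside K, [r] below is not
   nilpotent modulo J, so J has a constant zero [c] at which [r] does not vanish. *)
Lemma fixed_field a :
  (forall c (sigma : {rmorphism M -> M}), galois_mx c ->
     (forall p, sigma (evZ p) = evc c p) -> sigma a = a) ->
  exists x, iota x = a.
Proof.
move=> fa; apply: contrapT => nK.
have [p [q [q0 apq]]] := fractions pvM a.
have [D DE] := det_poly.
have D0 : evZ D != 0 by rewrite DE (wronsky_unit pvM).
(* Where [r] does not vanish, the factor [twist D] makes [c] invertible, and the other factor equals
   [sigma (evZ q) * (sigma a - a)]. *)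
pose r := twist D * (twist p - a *: twist q).
have [|P pP [JP Pr]] := prime_avoiding (r := r) (@noetherian_mpoly M (n * n)) J_ideal.
  by move=> N /(nilpotent_fixed q0 D0 apq).
have [k [e [s [ie _ rE]]]] := mpoly_basis_expansion j r.
have iP : is_ideal P by case: pP.
have [i Psi] : exists i, ~ P (map_mpoly j (s i)).
  apply: contrapT => h; apply: Pr; rewrite rE; apply: (ideal_sum _ iP) => i _.
  rewrite -mul_mpolyC; case: iP => _ _; apply; apply: contrapT => hi; apply: h; by exists i.
have [c0 [cP csi]] := nullstellensatz closedC (prime_preim (map_mpoly j) pP) Psi.
pose c : 'M[C]_n := vec_mx (\row_k c0 k).
have cE : (fun k => mxvec c 0 k) = c0 by apply/funext => l; rewrite vec_mxK mxE.
(* The point [c] is only known to kill the polynomials over [C] whose image lies in [P]. Minimal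
   supports reduce [J] to elements with coefficients of derivative zero, and these come from [C]. *)
have J0 T : J T -> ev_const iota c T = 0.
  have [d [dd dE]] := map_der_derivation.
  apply: (@span_of_invariants M (n * n) J (fun phi => phi = @der M) (fun T => ev_const iota c T = 0)).
  - by case: J_ideal.
  - by move=> x T' JT; rewrite -mul_mpolyC; case: J_ideal => _ _; apply.
  - by move=> _ ->; rewrite der0 der1.
  - move=> _ S T' -> JS TS; have -> : T' = d S by apply/mpolyP => m; rewrite TS dE.
    exact: J_der.
  - exact: rmorph0.
  - by move=> S T' hS hT; rewrite rmorphD hS hT addr0.
  - by move=> x S hS; rewrite evmZ hS mulr0.
  move=> S JS cS; have /choice [t tE] m : exists x : C, j x = S@_m.
    by apply: (const_embP pvM); apply: cS.
  pose S0 : {mpoly C[n * n]} := \sum_(m <- msupp S) t m *: 'X_[m].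
  have eS : S = map_mpoly j S0.
    rewrite [LHS]mpolyE rmorph_sum; apply: eq_bigr => m _.
    by rewrite [RHS]map_mpolyZ map_mpolyX tE.
  rewrite eS /ev_const evm_map_mpoly -(evm_comp (g := idfun) (phi := j)) //.
  by rewrite -mx_evalE /mx_eval cE cP ?rmorph0 //= -eS; apply: JP.
have rc : ev_const iota c r != 0.
  apply/eqP; rewrite ev_constE rE => /(lin_indep_eq0 _ _ ie) /(_ i).
  by move=> si0; move/eqP: csi; apply; rewrite -cE; exact: si0.
move: rc; rewrite rmorphM rmorphB evmZ !ev_const_twist mulf_eq0 negb_or => /andP[Dc rc].
have gc : galois_mx c.
  split; last by move=> s0 hs; rewrite -ev_const_twist; apply: J0; apply: ideal_gen_mem; exists s0.
  move: Dc; rewrite /ev_galois DE det_mulmx mulf_eq0 negb_or det_map_mx fmorph_eq0.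
  by rewrite unitmxE unitfE => /andP[].
have [sigma _ sE] := galois_aut pvM gc.
move/eqP: rc; apply; rewrite -!sE -apq rmorphM (fa c sigma gc sE) subrr //.
Qed.

End GaloisCorrespondence.

(** * Generic points of a subgroup of finite index *)

Section Artin.
Variables (K M : diffFieldType) (iota : {rmorphism K -> M}) (n : nat) (u : 'I_n -> M).
Hypothesis pvM : picard_vessiot iota u.
Hypothesis char0 : [pchar K] =i pred0.
Local Notation C := (constants K).
Hypothesis closedC : GRing.closed_field_axiom C.
Local Notation j := (const_emb iota).
Local Notation Z := (wronsky u).
Local Notation evZ := (evm iota (wronsky u)).
Local Notation evc := (ev_galois iota u).
Local Notation galois_mx := (is_galois_mx iota u).

Variable H0 : algGroup C n.
Local Notation H := (algGroup_set H0).
Hypothesis HG : forall c, H c -> galois_mx c.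
Hypothesis index_H : exists s : seq 'M[C]_n,
  forall g, galois_mx g -> exists2 c, c \in s & galois_mx c /\ H (invmx c *m g).

Let H1 : H 1%:M. Proof. by case: (algGroupP H0). Qed.
Let HM a b : H a -> H b -> H (a *m b). Proof. by case: (algGroupP H0) => _ _ + _; apply. Qed.
Let HV a : H a -> H (invmx a). Proof. by case: (algGroupP H0) => _ _ _; apply. Qed.

(* The relations over M satisfied by the generic point [c Z] of [H Z]. *)
Definition generic_relation (T : {mpoly M[n * n]}) :=
  forall c, H c -> evm idfun (map_mx j c *m Z) T = 0.

Lemma generic_relation_ideal : is_ideal generic_relation.
Proof.
split=> [c _|x y hx hy c Hc|a x hx c Hc]; first exact: rmorph0.
  by rewrite rmorphD hx // hy // addr0.
by rewrite rmorphM hx // mulr0.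
Qed.

Lemma aut_eq (sigma tau : {rmorphism M -> M}) :
  (forall p, sigma (evZ p) = tau (evZ p)) -> sigma =1 tau.
Proof.
move=> e x; have [p [q [q0 xpq]]] := fractions pvM x.
have sq0 : sigma (evZ q) != 0 by rewrite fmorph_eq0.
by apply: (mulIf sq0); rewrite -rmorphM xpq !e -xpq rmorphM.
Qed.

Lemma aut_const c (sigma : {rmorphism M -> M}) (a : 'M[C]_n) :
  (forall p, sigma (evZ p) = evc c p) -> map_mx sigma (map_mx j a) = map_mx j a.
Proof.
move=> sE; apply/matrixP => i k; rewrite !mxE /=.
by have := sE (val (a i k))%:MP; rewrite [evZ _]evmC /ev_galois evmC.
Qed.

(** The order is reversed because [sigma] fixes the constant matrix [d], so it sends [d Z] to
    [d c Z]. *)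
Lemma aut_comp c d (sigma tau rho : {rmorphism M -> M}) :
  (forall p, sigma (evZ p) = evc c p) -> (forall p, tau (evZ p) = evc d p) ->
  (forall p, rho (evZ p) = evc (d *m c) p) -> sigma \o tau =1 rho.
Proof.
move=> sE tE rE; apply: aut_eq => p.
transitivity (sigma (tau (evZ p))) => //; rewrite tE rE /ev_galois.
rewrite (evm_comp (phi := sigma) (h := iota)) => [|x]; last first.
  by have := sE x%:MP; rewrite [evZ _]evmC /ev_galois evmC.
by rewrite !map_mxM (aut_const _ sE) (galois_aut_u sE) mulmxA.
Qed.

Lemma aut_eval c (sigma : {rmorphism M -> M}) T a :
  (forall p, sigma (evZ p) = evc c p) ->
  sigma (evm idfun (map_mx j a *m Z) T) =
  evm idfun (map_mx j (a *m c) *m Z) (map_mpoly sigma T).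
Proof.
move=> sE; rewrite (evm_comp (h := sigma)) // evm_map_mpoly.
by rewrite !map_mxM (aut_const _ sE) (galois_aut_u sE) mulmxA.
Qed.

(* The product of the finitely many conjugates of [T] under the Galois group has
   coefficients in K, so it is a relation of [Z] over K. *)
Lemma invariant_relation (S : pred 'I_(n * n)) T :
  independent_vars (fun p => evZ p = 0) S ->
  (forall c (sigma : {rmorphism M -> M}), H c -> (forall p, sigma (evZ p) = evc c p) ->
     map_mpoly sigma T = T) ->
  vars_in S T -> evm idfun Z T = 0 -> T = 0.
Proof.
move=> indS invT vT T0.
have /choice [sg sgP] (c : 'M[C]_n) : exists sigma : {rmorphism M -> M},
    galois_mx c -> forall p, sigma (evZ p) = evc c p.
  have [gc|ngc] := pselect (galois_mx c); last by exists idfun.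
  by have [sigma _ sE] := galois_aut pvM gc; exists sigma.
have [s sP] := index_H.
(* The cosets [c H] are inverted because composition reverses the order: for [h] in [H], the
   conjugate of [T] by [h * c^-1] is its conjugate by [c^-1]. *)
pose s' := [seq invmx c | c <- s & `[< galois_mx c >]].
have gs' c : c \in s' -> galois_mx c.
  by case/mapP=> d; rewrite mem_filter => /andP[/asboolP gd _] ->; apply: galois_mxV.
pose L := undup [seq map_mpoly (sg c) T | c <- s'].
have LP g (sigma : {rmorphism M -> M}) : galois_mx g -> (forall p, sigma (evZ p) = evc g p) ->
    map_mpoly sigma T \in L.
  move=> gg sE; have gV := galois_mxV gg.
  have [c cs [gc Hcg]] := sP _ gV.
  have gcV := galois_mxV gc.
  rewrite mem_undup; apply/mapP; exists (invmx c).
    by apply: map_f; rewrite mem_filter cs andbT; apply/asboolP.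
  set h := invmx c *m invmx g in Hcg.
  have uc : c \in unitmx by case: gc.
  have ug : g \in unitmx by case: gg.
  have uh : h \in unitmx by rewrite unitmx_mul !unitmx_inv uc.
  have ghc : invmx h *m invmx c = g.
    apply: (can_inj (mulKmx uh)); rewrite mulKVmx // -mulmxA mulVmx // mulmx1 //.
  have GhV := HG (HV Hcg).
  have := aut_comp (sgP _ gcV) (sgP _ GhV) (rho := sigma).
  rewrite ghc => /(_ sE) eqs.
  rewrite -[in RHS](invT _ _ (HV Hcg) (sgP _ GhV)).
  apply/mpolyP => m; rewrite !mcoeff_map_mpoly; exact/esym/eqs.
have TL : T \in L.
  have := LP _ (sg 1%:M) (galois_mx1 iota u) (sgP _ (galois_mx1 iota u)).
  by rewrite (invT _ _ H1 (sgP _ (galois_mx1 iota u))).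
pose N := \prod_(T' <- L) T'.
have permL g (sigma : {rmorphism M -> M}) : galois_mx g -> (forall p, sigma (evZ p) = evc g p) ->
    perm_eq (map (map_mpoly sigma) L) L.
  move=> gg sE.
  have uL : uniq (map (map_mpoly sigma) L).
    by rewrite map_inj_uniq ?undup_uniq //; apply: map_mpoly_inj.
  have sub : {subset map (map_mpoly sigma) L <= L}.
    move=> x /mapP [T' + ->]; rewrite mem_undup => /mapP [c /gs' gc ->].
    have gcg := galois_mxM gc gg.
    have -> : map_mpoly sigma (map_mpoly (sg c) T) = map_mpoly (sg (c *m g)) T.
      apply/mpolyP => m; rewrite !mcoeff_map_mpoly.
      exact: (aut_comp sE (sgP _ gc) (sgP _ gcg)).
    exact: LP (sgP _ gcg).
  have [|_ eqL] := uniq_min_size uL sub; first by rewrite size_map.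
  by apply: uniq_perm; rewrite ?undup_uniq.
have [N0 eN0] : exists N0, N = map_mpoly iota N0.
  have /choice [t tE] m : exists x, iota x = N@_m.
    apply: (fixed_field pvM char0 closedC) => c sigma gc sE.
    rewrite -mcoeff_map_mpoly rmorph_prod; congr mcoeff.
    by rewrite -[LHS](big_map (map_mpoly sigma) xpredT id) (perm_big _ (permL _ _ gc sE)).
  exists (\sum_(m <- msupp N) t m *: 'X_[m]).
  rewrite [LHS]mpolyE rmorph_sum; apply: eq_bigr => m _.
  by rewrite [RHS]map_mpolyZ map_mpolyX tE.
have vN : vars_in S N.
  rewrite /N big_seq; apply: (big_ind (vars_in S)) => [|T1 T2|T'].
  - by apply: supp_in1 => i _; rewrite mnm0E.
  - exact: vars_inM.
  by rewrite mem_undup => /mapP [c _ ->]; apply: supp_in_map.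
have N00 : N0 = 0.
  apply: indS.
    by move=> m mN; apply: vN; rewrite mcoeff_msupp eN0 mcoeff_map_mpoly fmorph_eq0 -mcoeff_msupp.
  rewrite -evm_map_mpoly -eN0 rmorph_prod /=; apply/eqP; rewrite prodf_seq_eq0.
  by apply/hasP; exists T => //=; apply/eqP.
have /eqP : N = 0 by rewrite eN0 N00 rmorph0.
rewrite prodf_seq_eq0 => /hasP [T' + /= /eqP T'0]; rewrite mem_undup => /mapP [c _ eT'].
by apply: (map_mpoly_inj (g := sg c)); rewrite -eT' T'0 rmorph0.
Qed.

Lemma generic_independent (S : pred 'I_(n * n)) :
  independent_vars (fun p => evZ p = 0) S -> independent_vars generic_relation S.
Proof.
move=> indS T vT relT.
have [g0 gD gM] := generic_relation_ideal.
apply: (@span_of_invariants M (n * n) (fun T => vars_in S T /\ generic_relation T)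
  (fun phi => exists c (sigma : {rmorphism M -> M}), [/\ H c, forall p, sigma (evZ p) = evc c p &
     phi = fun x => sigma x - x]) (fun T => T = 0)) => //.
- by move=> p q [vp gp] [vq gq]; split; [exact: supp_inD|exact: gD].
- by move=> a p [vp gp]; split; [exact: supp_inZ|rewrite -mul_mpolyC; exact: gM].
- by move=> _ [c [sigma [_ _ ->]]]; rewrite rmorph0 rmorph1 !subrr.
- move=> _ p q [c [sigma [Hc sE ->]]] [vp gp] pq.
  have -> : q = map_mpoly sigma p - p.
    by apply/mpolyP => m; rewrite pq mcoeffB mcoeff_map_mpoly.
  split.
    rewrite -scaleN1r; apply: supp_inD; last exact: supp_inZ.
    exact: supp_in_map.
  apply: (idealB generic_relation_ideal) => // d Hd.
  have uc : c \in unitmx by case: (HG Hc).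
  (* The value of [map_mpoly sigma p] at [d Z] is [sigma] of the value of [p] at [d c^-1 Z], again a
     point of [H Z]. *)
  have -> : d = d *m invmx c *m c by rewrite mulmxKV.
  by rewrite -(aut_eval _ _ sE) gp ?rmorph0 //; apply: HM => //; apply: HV.
- by move=> p q -> ->; rewrite addr0.
- by move=> a p ->; rewrite scaler0.
move=> p [vp gp] hp; apply: (invariant_relation indS) => // [c sigma Hc sE|].
  apply/mpolyP => m; rewrite mcoeff_map_mpoly; apply/eqP; rewrite -subr_eq0; apply/eqP.
  by apply: (hp (fun x => sigma x - x)); exists c, sigma.
by have := gp _ H1; rewrite map_mx1 mul1mx.
Qed.

Lemma generic_max_independent (S : pred 'I_(n * n)) :
  max_independent_vars (fun p => evZ p = 0) S -> max_independent_vars generic_relation S.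
Proof.
move=> [indS maxS]; split; first exact: generic_independent.
move=> i /maxS [p [vp ep p0]]; exists (map_mpoly iota p); split.
- exact: supp_in_map.
- by move=> c /HG [_ hc]; rewrite evm_map_mpoly; apply: hc.
by apply: contra_neq p0 => e; apply: (map_mpoly_inj (g := iota)); rewrite e rmorph0.
Qed.

Definition constant_relation (T : {mpoly M[n * n]}) := forall c, H c -> ev_const iota c T = 0.

Hypothesis irrH : irreducible_set H.

(** At each point of [H] all components of [S] over [C] vanish or all those of [T] do, so every
    product of a component of [S] with one of [T] vanishes on [H], and irreducibility over [C]
    applies. *)
Lemma constant_relation_prime : is_prime constant_relation.
Proof.
split; [split=> [c _|x y hx hy c Hc|a x hx c Hc]| |].
- exact: rmorph0.
- by rewrite rmorphD hx // hy // addr0.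
- by rewrite rmorphM hx // mulr0.
- by move/(_ _ H1)/eqP; rewrite rmorph1 oner_eq0.
move=> S T hST.
have [k [p [pP _]]] := ev_const_eq0 iota S; have [l [q [qP _]]] := ev_const_eq0 iota T.
have [|nS] := pselect (constant_relation S); [by left|right=> c Hc; apply/qP => b].
have [d Hd nSd] : exists2 d, H d & ev_const iota d S <> 0.
  by apply: contrapT => h; apply: nS => d Hd; apply: contrapT => ?; apply: h; exists d.
have [a pa] : exists a, mx_eval (p a) d <> 0.
  by apply: contrapT => h; apply/nSd/pP => a; apply: contrapT => ?; apply: h; exists a.
have [|/(_ d Hd)//|] := irrH (p := p a) (q := q b); last by apply.
move=> x Hx; rewrite mx_evalM; have /eqP := hST x Hx; rewrite rmorphM mulf_eq0.
by case/orP => /eqP; [move/pP => ->|move/qP => ->]; rewrite ?mul0r ?mulr0.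
Qed.

Lemma generic_relation_prime : is_prime generic_relation.
Proof.
have := prime_preim (subst_r Z) constant_relation_prime; congr is_prime.
apply/funext => T; apply/propext; split=> h c Hc; have := h c Hc.
  by rewrite /ev_const evm_subst_r map_mx_id.
by rewrite /ev_const evm_subst_r map_mx_id.
Qed.

End Artin.

(** * Polynomials in renamed variables and coordinate rings *)

Section BoxPolynomials.
Variables (F : fieldType) (e m : nat).

Definition box_mnm (x : {ffun 'I_e -> 'I_m}) : 'X_{1..e} := [multinom (x i : nat) | i < e].

Definition box_poly (c : {ffun 'I_e -> 'I_m} -> F) : {mpoly F[e]} :=
  \sum_x c x *: 'X_[box_mnm x].

Lemma box_mnm_inj : injective box_mnm.
Proof.
move=> x y /mnmP exy; apply/ffunP => i; apply: val_inj.
by have := exy i; rewrite !mnmE.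
Qed.

Lemma box_poly_eq0 c : box_poly c = 0 -> forall x, c x = 0.
Proof.
move=> c0 x; have := congr1 (mcoeff (box_mnm x)) c0.
rewrite mcoeff0 raddf_sum (bigD1 x) //= mcoeffZ mcoeffX eqxx mulr1 big1 ?addr0 //.
by move=> y yx; rewrite mcoeffZ mcoeffX (inj_eq box_mnm_inj) (negbTE yx) mulr0.
Qed.

Lemma mmap_box_poly (A : comNzRingType) (f : {rmorphism F -> A}) s c :
  mmap f s (box_poly c) = \sum_x f (c x) * \prod_i s i ^+ x i.
Proof.
rewrite raddf_sum; apply: eq_bigr => x _; rewrite /= mmapZ mmapX.
by congr (_ * _); apply: eq_bigr => i _; rewrite mnmE.
Qed.

End BoxPolynomials.

Lemma mmap_comp (F : nzRingType) (A B : comNzRingType) k (g : {rmorphism F -> A})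
    (h : {rmorphism F -> B}) (phi : {rmorphism A -> B}) (v : 'I_k -> A) p :
  (forall x, phi (g x) = h x) -> phi (mmap g v p) = mmap h (phi \o v) p.
Proof.
move=> gh; elim/mpoly_ring_ind: p => [c|i|p q ep eq|p q ep eq].
- by rewrite mmapC [RHS]mmapC gh.
- by rewrite mmapX mmap1U [RHS]mmapX mmap1U.
- by rewrite !rmorphD /= ep eq.
by rewrite !rmorphM /= ep eq.
Qed.

Section Renaming.
Variables (F : fieldType) (d N : nat) (f : 'I_d -> 'I_N).
Hypothesis injf : injective f.

Definition rename : {rmorphism {mpoly F[d]} -> {mpoly F[N]}} :=
  mmap (@mpolyC N F) (fun k => 'X_(f k)).

Lemma mmap_rename (A : comNzRingType) (g : {rmorphism F -> A}) v p :
  mmap g v (rename p) = mmap g (v \o f) p.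
Proof.
rewrite (mmap_comp (phi := mmap g v) (h := g)) => [|x]; last exact: mmapC.
by congr mmap; apply/funext => k /=; rewrite mmapX mmap1U.
Qed.

Lemma rename_inj p : rename p = 0 -> p = 0.
Proof.
pose back i : {mpoly F[d]} := if [pick k | f k == i] is Some k then 'X_k else 0.
move=> p0; have := mmap_rename (@mpolyC d F) back p; rewrite p0 rmorph0 => ->.
elim/mpoly_ring_ind: p {p0} => [c|k|p q ep eq|p q ep eq].
- by rewrite mmapC.
- rewrite mmapX mmap1U /= /back; case: pickP => [l /eqP /injf -> //|/(_ k)].
  by rewrite eqxx.
- by rewrite [in RHS]rmorphD /= -ep -eq.
by rewrite [in RHS]rmorphM /= -ep -eq.
Qed.

Lemma vars_in_rename (S : pred 'I_N) p : (forall k, S (f k)) -> vars_in S (rename p).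
Proof.
move=> Sf; elim/mpoly_ring_ind: p => [c|k|p q ep eq|p q ep eq].
- have -> : rename c%:MP = c *: 1 by rewrite -mul_mpolyC mulr1; apply: mmapC.
  by apply: supp_inZ; apply: supp_in1 => i _; rewrite mnm0E.
- rewrite /rename /= mmapX mmap1U; apply: supp_inX => i Si; rewrite mnm1E.
  by case: eqP Si => [<-|//]; rewrite Sf.
- by rewrite [rename _]rmorphD; apply: supp_inD.
by rewrite [rename _]rmorphM; apply: vars_inM.
Qed.

End Renaming.

Section CoordinateRing.
Local Open Scope quotient_scope.
Variables (C : fieldType) (n : nat) (H : algGroup C n).

Definition coord_pi : {rmorphism {mpoly C[n * n]} -> coord_ring H} :=
  \pi_({ideal_quot (vanishing_ideal H)}).

Lemma coord_pi_eq0 p : coord_pi p = 0 <-> vanishes p H.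
Proof.
have -> : coord_pi p = 0 <-> p \in vanishing_ideal H.
  rewrite -[p]subr0 -(rmorph0 coord_pi) (Quotient.idealrBE (vanishing_ideal H)) subr0.
  by split=> [/eqP|/eqP].
by split=> [/asboolP h x Hx|h]; [exact: h|apply/asboolP].
Qed.

Lemma mmap_coord_pi k (s : 'I_k -> coord_ring H) (P : 'I_k -> {mpoly C[n * n]}) p :
  (forall i, coord_pi (P i) = s i) ->
  mmap (@coord_ringC C n H) s p = coord_pi (mmap (@mpolyC (n * n) C) P p).
Proof.
move=> sP; rewrite /mmap rmorph_sum; apply: eq_bigr => m _; rewrite rmorphM; congr (_ * _).
by rewrite /mmap1 rmorph_prod; apply: eq_bigr => i _; rewrite rmorphXn sP.
Qed.

Lemma coord_pi_surj x : exists p, coord_pi p = x.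
Proof. by exists (repr x); apply: reprK. Qed.

End CoordinateRing.

(** * Dimension *)

Lemma deg_le_monomial (F : nzRingType) n e m b (p : 'I_e -> {mpoly F[n]})
    (x : {ffun 'I_e -> 'I_m}) :
  (forall i, deg_le b (p i)) -> deg_le (e * m * b) (\prod_i p i ^+ x i).
Proof.
move=> hp; apply: (@deg_leW _ _ (\sum_i x i * b)%N).
  rewrite -big_distrl leq_mul2r; apply/orP; right.
  apply: leq_trans (_ : \sum_(i < e) m <= _)%N; last by rewrite sum_nat_const card_ord.
  by apply: leq_sum => i _; apply: ltnW.
by apply: deg_le_prod => i; apply: deg_le_exp.
Qed.

Section Dimension.
Variables (K M : diffFieldType) (iota : {rmorphism K -> M}) (n : nat) (u : 'I_n -> M).
Hypothesis pvM : picard_vessiot iota u.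
Hypothesis char0 : [pchar K] =i pred0.
Local Notation C := (constants K).
Hypothesis closedC : GRing.closed_field_axiom C.
Local Notation j := (const_emb iota).
Local Notation Z := (wronsky u).
Local Notation evZ := (evm iota (wronsky u)).
Local Notation galois_mx := (is_galois_mx iota u).

Variable S : pred 'I_(n * n).
Hypothesis maxS : max_independent_vars (fun p => evZ p = 0) S.

Let enumS_in (k : 'I_#|S|) : S (enum_val k).
Proof. by have := enum_valP k; rewrite unfold_in. Qed.

Lemma field_trdeg : has_trdeg iota #|S|.
Proof.
split.
  exists (fun k => mxvec Z 0 (enum_val k)) => p p0.
  apply: (rename_inj (@enum_val_inj _ S)); case: maxS => indS _; apply: indS.
    exact: vars_in_rename.
  by rewrite /evm /= mmap_rename.
move=> e s inds; rewrite leqNgt; apply/negP => Se.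
have /choice [pq pqP] i : exists pq, evZ pq.2 != 0 /\ s i * evZ pq.2 = evZ pq.1.
  by have [p [q h]] := fractions pvM (s i); exists (p, q).
pose q := \prod_i (pq i).2; pose p i := (pq i).1 * \prod_(k | k != i) (pq k).2.
have q0 : evZ q != 0 by rewrite rmorph_prod; apply/prodf_neq0 => i _; case: (pqP i).
have pE i : s i * evZ q = evZ (p i).
  by rewrite /q (bigD1 i) //= !rmorphM mulrA; case: (pqP i) => _ ->.
clearbody q p.
have [b1 hb1] := deg_le_bound p; have [b2 hb2] := deg_le_exists q.
have [m hm] := growth_dependence (evZ_prime iota u) maxS (e * b1 + e * b2) Se.
(* The powers of the common denominator [q] are completed to [m] in each factor, so [W x] evaluates
   to the monomial in the [s i] times a factor independent of [x]. *)
pose W (x : {ffun 'I_e -> 'I_m}) := (\prod_i p i ^+ x i) * \prod_(i < e) q ^+ (m - x i).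
have [|c [x cx] cW] := hm W.
  move=> x; rewrite mulnDl; apply: deg_leM.
    by rewrite mulnAC; apply: deg_le_monomial.
  rewrite mulnAC.
  apply: (@deg_leW _ _ (\sum_(i < e) (m - x i) * b2)%N).
    rewrite -big_distrl leq_mul2r; apply/orP; right.
    apply: leq_trans (_ : \sum_(i < e) m <= _)%N; last by rewrite sum_nat_const card_ord.
    by apply: leq_sum => i _; apply: leq_subr.
  by apply: deg_le_prod => i; apply: deg_le_exp.
have WE x' : evZ (W x') = (\prod_i s i ^+ x' i) * \prod_(i < e) evZ q ^+ m.
  rewrite rmorphM !rmorph_prod -!big_split /=; apply: eq_bigr => i _.
  rewrite !rmorphXn -pE exprMn -mulrA -exprD subnKC //; apply/ltnW/ltn_ord.
have qm0 : \prod_(i < e) evZ q ^+ m != 0 by apply/prodf_neq0 => i _; rewrite expf_neq0.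
move/eqP: cx; apply; apply: (box_poly_eq0 (c := c)); apply: inds.
rewrite mmap_box_poly; apply: (mulIf qm0); rewrite mul0r -[RHS]cW rmorph_sum mulr_suml.
by apply: eq_bigr => y _; rewrite evmZ WE mulrA.
Qed.

Variable H0 : algGroup C n.
Local Notation H := (algGroup_set H0).
Hypothesis HG : forall c, H c -> galois_mx c.
Hypothesis index_H : exists s : seq 'M[C]_n,
  forall g, galois_mx g -> exists2 c, c \in s & galois_mx c /\ H (invmx c *m g).
Hypothesis irrH : irreducible_set H.

Let H1 : H 1%:M. Proof. by case: (algGroupP H0). Qed.

Lemma lin_indep_generic (I : finType) (c : I -> M) (q : I -> {mpoly C[n * n]}) r
    (e : 'I_r -> M) (B : I -> 'I_r -> C) :
  lin_indep j e -> (forall x, c x = \sum_k j (B x k) * e k) ->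
  (forall h, H h -> \sum_x c x * j (mx_eval (q x) h) = 0) ->
  forall k, vanishes (\sum_x B x k *: q x) H.
Proof.
move=> ie cB hc k h Hh; rewrite mx_evalE rmorph_sum.
under eq_bigr do rewrite evmZ.
apply: (ie (fun k => \sum_x B x k * mx_eval (q x) h)); rewrite -[RHS](hc h Hh).
under eq_bigr do rewrite rmorph_sum mulr_suml.
rewrite exchange_big /=; apply: eq_bigr => x _; rewrite cB mulr_suml.
by apply: eq_bigr => l _; rewrite rmorphM mulrAC.
Qed.

Lemma generic_eval psi (p : {mpoly C[n * n]}) h :
  (forall W p, evm idfun W (psi p) = evm idfun (W *m invmx Z) p) ->
  evm idfun (map_mx j h *m Z) (psi (map_mpoly j p)) = j (mx_eval p h).
Proof.
move=> ->; rewrite mulmxK; last by rewrite unitmxE unitfE (wronsky_unit pvM).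
by rewrite evm_map_mpoly mx_evalE (evm_comp (h := j)).
Qed.

(** Since c = (c Z) Z^-1, lifts of the [s i] become polynomials over [M] in the generic point, whose
    growth is governed by [#|S|]. The resulting dependence has coefficients in [M]; a nonzero
    coordinate of it over [C] gives a relation among the [s i]. *)
Lemma coord_ring_bound e (s : 'I_e -> coord_ring H0) :
  alg_independent (@coord_ringC C n H0) s -> (e <= #|S|)%N.
Proof.
move=> inds; rewrite leqNgt; apply/negP => Se.
have /choice [P PE] i : exists p, coord_pi H0 p = s i by apply: coord_pi_surj.
have [psi [_ _ psiE]] := untwist pvM.
pose p i := psi (map_mpoly j (P i)).
have [b hb] := deg_le_bound p.
have pr := generic_relation_prime iota u irrH.
have mx := generic_max_independent pvM char0 closedC HG index_H maxS.
have [m hm] := growth_dependence pr mx (e * b) Se.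
have [|c [x cx] cW] := hm (fun x => \prod_i p i ^+ x i).
  by move=> x; rewrite mulnAC; apply: deg_le_monomial.
have [r [f [B [indf cB]]]] := finite_basis j c.
have vB k : vanishes (\sum_x B x k *: \prod_i P i ^+ x i) H.
  apply: (lin_indep_generic indf cB) => h Hh; rewrite -[RHS](cW h Hh) rmorph_sum.
  apply: eq_bigr => y _; rewrite evmZ; congr (_ * _).
  rewrite mx_evalE !rmorph_prod; apply: eq_bigr => i _.
  by rewrite !rmorphXn /p (generic_eval _ _ psiE) mx_evalE.
move/eqP: cx; apply; rewrite cB big1 // => k _.
have -> : B x k = 0; last by rewrite rmorph0 mul0r.
apply: (box_poly_eq0 (c := fun x => B x k)); apply: inds.
rewrite (mmap_coord_pi _ PE); apply/coord_pi_eq0.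
rewrite mmap_box_poly; have := vB k; congr vanishes.
by apply: eq_bigr => y _; rewrite mul_mpolyC.
Qed.

(** A maximal independent set [S'] for [H] over [C] stays maximal independent over [M]. The entries
    of c Z are polynomials over [M] in those of c, so more than [#|S'|] of them would be dependent
    on [H], which the generic independence of [S] excludes. *)
Lemma coord_ring_independent :
  exists s : 'I_#|S| -> coord_ring H0, alg_independent (@coord_ringC C n H0) s.
Proof.
have prH : is_prime (fun p : {mpoly C[n * n]} => vanishes p H) := vanishing_is_prime H1 irrH.
have [S' [indS' maxS']] := max_independent_vars_exists prH.
have maxM : max_independent_vars (constant_relation iota H0) S'.
  split=> [T vT relT|i /maxS' [p [vp hp p0]]].
    have [r [e [q [ie qT eT]]]] := mpoly_basis_expansion j T.
    rewrite eT big1 // => k _; rewrite (indS' (q k)) ?rmorph0 ?scaler0 //.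
      by move=> m /qT/vT.
    move=> h Hh; have := relT h Hh; rewrite ev_constE eT => /(lin_indep_eq0 _ _ ie).
    exact.
  exists (map_mpoly j p); split; first exact: supp_in_map.
    move=> h Hh; rewrite /ev_const evm_map_mpoly -(evm_comp (g := idfun) (phi := j)) //.
    by rewrite -mx_evalE hp // rmorph0.
  by apply: contra_neq p0 => e; apply: (map_mpoly_inj (g := j)); rewrite e rmorph0.
have SS' : (#|S| <= #|S'|)%N.
  rewrite leqNgt; apply/negP => S'S.
  pose p (k : 'I_#|S|) := subst_r Z ('X_(enum_val k) : {mpoly M[n * n]}).
  have [b hb] := deg_le_bound p.
  have [m hm] := growth_dependence (constant_relation_prime iota irrH) maxM (#|S| * b) S'S.
  have [|c [x cx] cW] := hm (fun x => \prod_i p i ^+ x i).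
    by move=> x; rewrite mulnAC; apply: deg_le_monomial.
  move/eqP: cx; apply; apply: (box_poly_eq0 (c := c)).
  apply: (rename_inj (@enum_val_inj _ S)).
  have [indM _] := generic_max_independent pvM char0 closedC HG index_H maxS.
  apply: indM; first exact: vars_in_rename.
  have renE : rename M (@enum_val _ S) (box_poly c) =
      \sum_x (c x)%:MP * \prod_i 'X_(enum_val i) ^+ x i by apply: mmap_box_poly.
  move=> h Hh; rewrite -[RHS](cW h Hh) renE !rmorph_sum.
  apply: eq_bigr => y _; rewrite rmorphM evmC evmZ; congr (_ * _).
  rewrite !rmorph_prod; apply: eq_bigr => i _; rewrite !rmorphXn /p /ev_const evm_subst_r map_mx_id //.
pose f (k : 'I_#|S|) := enum_val (widen_ord SS' k).
have injf : injective f by move=> k l /enum_val_inj /(congr1 val) /= /val_inj.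
exists (fun k => coord_pi H0 'X_(f k)) => p.
rewrite (mmap_coord_pi (P := fun k => 'X_(f k))) // => /coord_pi_eq0 vp.
apply: (rename_inj injf); apply: indS' => //; apply: vars_in_rename => k.
by have := enum_valP (widen_ord SS' k); rewrite unfold_in.
Qed.

Lemma group_trdeg : has_trdeg (@coord_ringC C n H0) #|S|.
Proof. by split; [exact: coord_ring_independent|exact: coord_ring_bound]. Qed.

End Dimension.

Theorem mainTheorem6 (K M : diffFieldType) (iota : {rmorphism K -> M})
    (n : nat) (u : 'I_n -> M)
    (char0 : [pchar K] =i pred0)
    (closedC : GRing.closed_field_axiom (constants K))
    (pvM : picard_vessiot iota u) :
  exists d : nat,
    has_group_dim (galois_matrices iota u) d /\ has_trdeg iota d.
Proof.
have algG := galois_algebraic pvM.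
have [H compH irrH] := identity_component_exists algG.
have [S maxS] := max_independent_vars_exists (evZ_prime iota u).
have [HG [s sP] _] := compH.
exists #|S|; split; last exact: field_trdeg maxS.
split=> //; exists H => //; apply: (group_trdeg pvM char0 closedC maxS) => //.
  by move=> c /HG /(galois_matricesE pvM).
exists s => g /(galois_matricesE pvM) /sP [c cs [Gc Hc]].
by exists c => //; split=> //; apply/(galois_matricesE pvM).
Qed.
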